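(* Let $n,m\ge 0$ be integers, let $p,q\in\mathbb C$ with $0<|p|,|q|<1$, and let $z=(z_1,\dots,z_{n+1})$, $y=(y_1,\dots,y_{m+1})$, $s=(s_1,\dots,s_{n+m+2})$, $t=(t_1,\dots,t_{n+m+2})$ be variables in $\mathbb C^*$ subject to the constraints $$\prod_{j=1}^{n+1}z_j=1,\qquad \prod_{j=1}^{m+1}y_j=S:=\prod_{l=1}^{n+m+2}s_l,\qquad \prod_{l=1}^{n+m+2}s_lt_l=(pq)^{m+1}.$$ Let $$ \rho(z,y;s,t;p,q)=\frac{\Delta_n(z;s,t;p,q)}{\Delta_m(y;s^{-1},pqt^{-1};p,q)}\prod_{k,r=1}^{n+m+2}\frac{1}{\Gamma_{p,q}(s_kt_r)}, $$ where $s^{-1}=(s_l^{-1})_l$, $pqt^{-1}=(pq/t_l)_l$; explicitly, $$ \rho(z,y;s,t;p,q)=\prod_{k,r=1}^{n+m+2}\frac{1}{\Gamma_{p,q}(s_kt_r)} \prod_{r=1}^{n+m+2}\frac{\prod_{j=1}^{n+1}\Gamma_{p,q}(s_rz_j,t_rz_j^{-1})}{\prod_{j=1}^{m+1}\Gamma_{p,q}(s_r^{-1}y_j,pqt_r^{-1}y_j^{-1})} \cdot\frac{\prod_{1\leq i<j\leq m+1}\Gamma_{p,q}(y_i^{-1}y_j,y_iy_j^{-1})}{\prod_{1\leq i<j\leq n+1}\Gamma_{p,q}(z_i^{-1}z_j,z_iz_j^{-1})}. $$ Then $\rho$ is a totally elliptic hypergeometric term. That is, eliminating $$z_{n+1}=\prod_{j=1}^n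 z_j^{-1},\qquad y_{m+1}=S\prod_{j=1}^m y_j^{-1},\qquad t_{n+m+2}=\frac{(pq)^{m+1}}{S\prod_{l=1}^{n+m+1}t_l}$$ and regarding $\rho$ as a function of the independent variables $x=(z_1,\dots,z_n,y_1,\dots,y_m,s_1,\dots,s_{n+m+2},t_1,\dots,t_{n+m+1})$, for every independent variable $x_a$ the $q$-certificate $$h_a(x;q;p)=\frac{\rho(\dots,qx_a,\dots)}{\rho(\dots,x_a,\dots)}$$ is a meromorphic function that is $p$-elliptic in each of the independent variables and in $q$: it is invariant under $x_b\mapsto px_b$ for every independent variable $x_b$ (the other independent variables and $q$ being fixed), and under $q\mapsto pq$ (all independent variables being fixed).
   Context: For $0<|p|,|q|<1$ and $z\in\mathbb C^*$, the elliptic gamma function is $$\Gamma_{p,q}(z)=\prod_{j,k=0}^\infty\frac{1-z^{-1}p^{j+1}q^{k+1}}{1-zp^{j}q^{k}}.$$ It satisfies $\Gamma_{p,q}(qz)=\theta_p(z)\Gamma_{p,q}(z)$, where $\theta_p(x)=\prod_{j\ge0}(1-xp^j)(1-x^{-1}p^{j+1})$. Convention: $\Gamma_{p,q}(a_1,\dots,a_k)=\prod_{i=1}^k\Gamma_{p,q}(a_i)$. Empty products equal $1$. With $n+m+2$ parameters $s_l$ and $n+m+2$ parameters $t_l$, the kernel of the type I $A_n$ elliptic hypergeometric integral is $$ \Delta_n(z;s,t;p,q)=\prod_{1\leq j<k\leq n+1}\frac{1}{\Gamma_{p,q}(z_jz_k^{-1},z_j^{-1}z_k)}\prod_{j=1}^{n+1}\prod_{l=1}^{n+m+2}\Gamma_{p,q}(s_lz_j,t_lz_j^{-1}),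 $$ and $\Delta_m$ is given by the same formula with $m+1$ variables and the same number $n+m+2$ of parameters of each kind (the constraint on the product of the variables being the one stated in the claim). A function $\Delta$ of independent variables $x_1,\dots,x_N\in\mathbb C^*$ (built from elliptic gamma functions with bases $p,q$) is called a totally elliptic hypergeometric term if all its $q$-certificates $h_a(x;q;p)=\Delta(\dots,qx_a,\dots)/\Delta(x)$, $a=1,\dots,N$, are $p$-elliptic functions of all the variables $x_1,\dots,x_N$ and of $q$; a meromorphic function is $p$-elliptic in a variable if it is unchanged when that variable is multiplied by $p$ and the other independent variables are fixed. (The certificates are finite products of functions $\theta_p$ of monomials in $x_1,\dots,x_N,q,p$ and their inverses, times monomials.) *)

(* Defs.v *)
From mathcomp Require Import all_boot all_order all_algebra.
From mathcomp Require Import complex.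
From mathcomp Require Import all_classical all_reals all_analysis.

Set Implicit Arguments.
Unset Strict Implicit.
Unset Printing Implicit Defensive.

Import Order.TTheory GRing.Theory Num.Theory.
Import numFieldNormedType.Exports.

Local Open Scope classical_set_scope.
Local Open Scope ring_scope.

(* Packing R[i] as a numFieldType gives it the topology of its modulus; moduli
   `|x| are real elements of CC R. *)
Definition CC (R : realType) : numFieldType := R[i].

Section Meromorphic.
Variables (R : realType) (V : normedModType (CC R)).

(* A meromorphic function is represented by a total function whose values on
   some closed nowhere dense set (poles, indeterminacies) are irrelevant. *)
Definition mero_eq (U : set V) (f g : V -> CC R) : Prop :=
  exists O : set V, [/\ open O, O `<=` U, U `<=` closure O
                      & forall x, O x -> f x = g x].

(* For an open set W: differentiability is Frechet over the field CC R. *)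
Definition holomorphic_on (W : set V) (f : V -> CC R) : Prop :=
  forall x, W x -> differentiable f x.

Definition meromorphic_on (U : set V) (f : V -> CC R) : Prop :=
  forall x, U x -> exists (W : set V) (F G : V -> CC R),
    [/\ [/\ open W, W x & W `<=` U],
        holomorphic_on W F, holomorphic_on W G,
        W `<=` closure [set y | W y /\ G y != 0]
      & mero_eq W f (fun y => F y / G y)].

End Meromorphic.

Section TotalEllipticity.
Variables (R : realType) (N : nat).
Notation C := (CC R).

Definition ctorus : set 'rV[C]_N := [set x | forall i, x 0 i != 0].

Definition scale_var (a : 'I_N) (c : C) (x : 'rV[C]_N) : 'rV[C]_N :=
  \row_i (if i == a then c * x 0 i else x 0 i).

Definition q_certificate (Delta : C -> 'rV[C]_N -> C) (a : 'I_N)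
    (q : C) (x : 'rV[C]_N) : C :=
  Delta q (scale_var a q x) / Delta q x.

(* Delta q x is a family in the base q.  The certificates are meromorphic
   jointly in (x, q), and in x for every fixed q; the periodicities are
   identities of meromorphic functions of x, for every fixed q. *)
Definition totally_elliptic (p : C) (Delta : C -> 'rV[C]_N -> C) : Prop :=
  forall a : 'I_N, let h := q_certificate Delta a in
  meromorphic_on [set u : 'rV[C]_N * C | ctorus u.1 /\ 0 < `|u.2| < 1]
                 (fun u => h u.2 u.1)
  /\ forall q : C, 0 < `|q| < 1 ->
     [/\ meromorphic_on ctorus (h q),
         forall b : 'I_N, mero_eq ctorus (fun x => h q (scale_var b p x)) (h q)
       & mero_eq ctorus (h (p * q)) (h q)].

End TotalEllipticity.

Section Term.
Variable R : realType.
Notation C := (CC R).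

(* The double product converges absolutely, so square partial products
   suffice; since 0^-1 = 0, the value at a pole is 0. *)
Definition ellGamma (p q z : C) : C :=
  lim ((fun K : nat => \prod_(j < K) \prod_(k < K)
          ((1 - z^-1 * p ^+ j.+1 * q ^+ k.+1) / (1 - z * p ^+ j * q ^+ k)))
       @ \oo).

(* k is the number of variables z, M the number of parameters of each kind. *)
Definition Delta_kernel (p q : C) (k M : nat)
    (z : 'I_k -> C) (s t : 'I_M -> C) : C :=
  (\prod_(i < k) \prod_(j < k | (i < j)%N)
     (ellGamma p q (z i * (z j)^-1) * ellGamma p q ((z i)^-1 * z j))^-1)
  * \prod_(j < k) \prod_(l < M)
     (ellGamma p q (s l * z j) * ellGamma p q (t l * (z j)^-1)).

Definition rho (n m : nat) (p q : C) (z : 'I_n.+1 -> C) (y : 'I_m.+1 -> C)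
    (s t : 'I_(n + m).+2 -> C) : C :=
  Delta_kernel p q z s t
  / Delta_kernel p q y (fun l => (s l)^-1) (fun l => p * q * (t l)^-1)
  * \prod_(k < (n + m).+2) \prod_(r < (n + m).+2) (ellGamma p q (s k * t r))^-1.

Definition append_last (k : nat) (v : 'I_k -> C) (c : C) (i : 'I_k.+1) : C :=
  if unlift ord_max i is Some j then v j else c.

Definition nvars (n m : nat) : nat := (n + (m + ((n + m).+2 + (n + m).+1)))%N.

(* The independent variables, in the order z, y, s, t, form a row vector; the
   last z, y and t are eliminated. *)
Definition rho_indep (n m : nat) (p q : C) (x : 'rV[C]_(nvars n m)) : C :=
  let z0 : 'rV[C]_n := lsubmx x in
  let y0 : 'rV[C]_m := lsubmx (rsubmx x) in
  let s : 'rV[C]_((n + m).+2) := lsubmx (rsubmx (rsubmx x)) in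
  let t0 : 'rV[C]_((n + m).+1) := rsubmx (rsubmx (rsubmx x)) in
  let S := \prod_l s 0 l in
  rho p q
    (append_last (z0 0) (\prod_j (z0 0 j)^-1))
    (append_last (y0 0) (S * \prod_j (y0 0 j)^-1))
    (s 0)
    (append_last (t0 0) ((p * q) ^+ m.+1 / (S * \prod_l t0 0 l))).

End Term.

(* Main.v *)
(* Every argument of an elliptic gamma function in rho is a monomial
   with integer exponents in x, q and p, so rho is a finite product of
   Gamma(M)^{+-1} over a list of exponent vectors.  By
   Gamma(q z) = theta_p(z) Gamma(z), a q-certificate is a finite product of
   theta_p(M)^{+-1}, and theta_p(p^B w) = (-w)^-B p^-(B(B-1)/2) theta_p(w) turns
   invariance under p-shifts (of an x_b or of q) into polynomial identities
   between the exponents.  They all follow from three facts about sums over the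
   signed list, valid for linear forms f subject to the balancing constraints:
   the cubic form in the centred values 2 f(M) - f(pq) vanishes, the linear form
   vanishes, and the quadratic form is even.

   Meromorphy only needs theta_p to be holomorphic on C^*, because the Gamma's
   disappear from the certificates; the identities hold off the closed nowhere
   dense set where some Gamma factor degenerates. *)
From HB Require Import structures.
Require Import Defs.
From mathcomp Require Import all_boot all_order all_algebra.
From mathcomp Require Import complex.
From mathcomp Require Import all_classical all_reals all_analysis.
From mathcomp Require Import ring lra zify.
Import Order.TTheory GRing.Theory Num.Theory.
Import numFieldNormedType.Exports.
Local Open Scope classical_set_scope.
Local Open Scope ring_scope.
Set Implicit Arguments.
Unset Strict Implicit.
Unset Printing Implicit Defensive.

(** * Infinite products and the theta and gamma functions *)

Section Modulus.
Variable R : realType.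
Notation C := (CC R).

(** The balancing constraints enter only through the linear moments of the four families z, y, s, t;
    the count n + m + 2 does the rest. In a cubic moment, s is counted n + 1 times by s + z and m +
    1 times by the inverted y - s, against n + m + 2 times by the inverted s + t; t balances in the
    same way, while z and y occur n + m + 2 times with each sign. The coordinate x_a along which the
    certificate is formed always fills one slot of the cubic form, and it vanishes on pq. Evenness
    is a separate condition because theta_p(pw) carries a minus sign, which exponent vectors do not
    record.

    The analytic obstacle is that a degenerate Gamma factor has a merely conventional value, so
    identities between certificates hold only generically. Ellipticity is asked for each fixed q,
    hence density is needed in every slice and not just jointly. It is available because every Gamma
    argument involves some independent variable x_i, including the arguments built from eliminated
    variables. *)

Definition modulus (x : C) : R := Normc.normc x.

Lemma normE (x : C) : `|x| = (modulus x)%:C%C.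
Proof. by rewrite normc_def /modulus; case: x. Qed.

Lemma modulusM (x y : C) : modulus (x * y) = modulus x * modulus y.
Proof. exact: Normc.normcM. Qed.

Lemma modulusD (x y : C) : modulus (x + y) <= modulus x + modulus y.
Proof. exact: le_normcD. Qed.

Lemma modulusN (x : C) : modulus (- x) = modulus x.
Proof. exact: normcN. Qed.

Lemma modulusB (x y : C) : modulus (x - y) = modulus (y - x).
Proof. by rewrite -modulusN opprB. Qed.

Lemma modulus0 : modulus 0 = 0. Proof. exact: Normc.normc0. Qed.
Lemma modulus1 : modulus 1 = 1. Proof. exact: Normc.normc1. Qed.

Lemma modulus_ge0 (x : C) : 0 <= modulus x.
Proof. by rewrite -lecR -normE normr_ge0. Qed.

Lemma modulusV (x : C) : modulus x^-1 = (modulus x)^-1.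
Proof. exact: ComplexField.Normc.normcV. Qed.

Lemma modulusX (x : C) n : modulus (x ^+ n) = modulus x ^+ n.
Proof. by elim: n => [|n IHn]; rewrite ?modulus1 // !exprS modulusM IHn. Qed.

Lemma modulus_eq0 (x : C) : (modulus x == 0) = (x == 0).
Proof.
apply/eqP/eqP => [|->]; first exact: Normc.eq0_normc.
exact: modulus0.
Qed.

Lemma modulus_gt0 (x : C) : (0 < modulus x) = (x != 0).
Proof. by rewrite lt_def modulus_eq0 modulus_ge0 andbT. Qed.

Lemma real_complexD (x y : R) : (x + y)%:C%C = x%:C%C + y%:C%C :> C.
Proof. exact: rmorphD. Qed.

Lemma modulus_real (x : R) : modulus (x%:C%C : C) = `|x|.
Proof. by rewrite /modulus /= expr0n addr0 sqrtr_sqr. Qed.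

Lemma modulus_ge_Re (x : C) : `|complex.Re x| <= modulus x.
Proof. by have := normc_ge_Re x; rewrite normE lecR. Qed.

Lemma modulus_ge_Im (x : C) : `|complex.Im x| <= modulus x.
Proof.
case: x => a b; rewrite /modulus /= -sqrtr_sqr ler_wsqrtr //.
by rewrite lerDr sqr_ge0.
Qed.

Lemma modulus_le_ReIm (x : C) :
  modulus x <= `|complex.Re x| + `|complex.Im x|.
Proof.
case: x => a b; rewrite /modulus /=.
rewrite -[leRHS]ger0_norm ?addr_ge0 // -sqrtr_sqr ler_wsqrtr // sqrrD.
by rewrite !real_normK ?num_real // lerD2r lerDl mulrn_wge0 // mulr_ge0.
Qed.

(** The radius of a ball in [CC R] is a positive complex number, so its imaginary part is zero; the
    estimates below can therefore all be made with a real [e]. *)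
Lemma cvg_modulusP (T : Type) (F : set_system T) (FF : Filter F)
    (f : T -> C) (l : C) :
  f @ F --> l <-> forall e : R, 0 < e -> \forall t \near F, modulus (l - f t) < e.
Proof.
split=> [/cvgrPdist_lt fl e e0|fl].
  have := fl e%:C%C; rewrite ltcR => /(_ e0).
  by apply: filterS => t; rewrite normE ltcR.
apply/cvgrPdist_lt => -[a b]; rewrite ltcE /= => /andP[/eqP -> a0].
by have := fl a a0; apply: filterS => t; rewrite normE ltcE /= eqxx.
Qed.

(* CC R has no complete structure in the library: converge in Re and Im. *)
Lemma geometric_increments_cvg (u : nat -> C) (B r : R) :
  0 <= r < 1 -> (forall k, modulus (u k.+1 - u k) <= B * r ^+ k) ->
  cvgn u.
Proof.
move=> /andP[r0 r1] uB.
have cvR (v : nat -> R) : (forall k, `|v k.+1 - v k| <= B * r ^+ k) -> cvgn v.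
  move=> vB.
  have : cvgn (series (telescope v)).
    apply: normed_cvg; apply: (@series_le_cvg _ _ (geometric B r)) => //.
    - by move=> n; exact: normr_ge0.
    - by move=> n; exact: (le_trans _ (vB n)).
    - by apply: is_cvg_geometric_series; rewrite ger0_norm.
  rewrite telescopeK => cv.
  rewrite [v](_ : _ = [sequence v n - v 0%N]_n \+ cst (v 0%N)); last first.
    by apply/funext => n /=; rewrite subrK.
  by apply: is_cvgD => //; exact: is_cvg_cst.
have cRe : cvgn (fun k => complex.Re (u k)).
  apply: cvR => k; apply: le_trans (uB k).
  by have := modulus_ge_Re (u k.+1 - u k); case: (u k) (u k.+1) => a b [c d].
have cIm : cvgn (fun k => complex.Im (u k)).
  apply: cvR => k; apply: le_trans (uB k).
  by have := modulus_ge_Im (u k.+1 - u k); case: (u k) (u k.+1) => a b [c d].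
set a := lim (_ @ _) in cRe; set b := lim (_ @ _) in cIm.
apply/cvg_ex; exists (a +i* b)%C.
apply/cvg_modulusP => e e0.
have e2 : 0 < e / 2 by rewrite divr_gt0.
move/cvgrPdist_lt/(_ _ e2): cRe => cRe; move/cvgrPdist_lt/(_ _ e2): cIm => cIm.
near=> n.
apply: (le_lt_trans (modulus_le_ReIm _)).
have -> : complex.Re ((a +i* b)%C - u n : C) = a - complex.Re (u n) by case: (u n).
have -> : complex.Im ((a +i* b)%C - u n : C) = b - complex.Im (u n) by case: (u n).
rewrite [e]splitr ltrD //; [near: n; exact: cRe | near: n; exact: cIm].
Unshelve. all: by end_near. Qed.

End Modulus.

(** * Infinite products whose factors approach 1 geometrically *)

Section Products.
Variable R : realType.
Notation C := (CC R).

Lemma geometric_sum_le (r : R) K : 0 <= r < 1 -> \sum_(j < K) r ^+ j <= (1 - r)^-1.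
Proof.
move=> /andP[r0 r1]; rewrite -[leRHS]mul1r ler_pdivlMr ?subr_gt0 // mulrC.
have -> : (1 - r) * \sum_(j < K) r ^+ j = 1 - r ^+ K.
  by rewrite -opprB mulNr -subrX1 opprB.
by rewrite gerBl exprn_ge0.
Qed.

(** Each factor is at most [1 + B * r ^+ k], hence at most the exponential of [B * r ^+ k], and
    these exponents sum to at most [B / (1 - r)] whatever [K] is. *)
Lemma modulus_prod_le (b : nat -> C) (B r : R) K : 0 <= r < 1 -> 0 <= B ->
  (forall k, modulus (b k - 1) <= B * r ^+ k) ->
  modulus (\prod_(j < K) b j) <= expR (B / (1 - r)).
Proof.
move=> r01 B0 bB; apply: (@le_trans _ _ (expR (B * \sum_(j < K) r ^+ j))); last first.
  by rewrite ler_expR ler_wpM2l // geometric_sum_le.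
elim: K => [|K IHK]; first by rewrite !big_ord0 mulr0 expR0 modulus1.
rewrite !big_ord_recr /= modulusM mulrDr expRD ler_pM ?modulus_ge0 //.
apply: le_trans (expR_ge1Dx _).
by rewrite -[b K](subrK 1) addrC (le_trans (modulusD _ _)) // modulus1 lerD2l.
Qed.

Lemma infinite_product_cvg (b : nat -> C) (B r : R) : 0 <= r < 1 -> 0 <= B ->
  (forall k, modulus (b k - 1) <= B * r ^+ k) ->
  cvgn (fun K => \prod_(j < K) b j).
Proof.
move=> r01 B0 bB; apply: (@geometric_increments_cvg _ _ (expR (B / (1 - r)) * B) r) => // k.
rewrite big_ord_recr /= -[X in _ - X]mulr1 -mulrBr modulusM -mulrA.
by rewrite ler_pM ?modulus_ge0 // modulus_prod_le.
Qed.

(** The reciprocals satisfy an estimate of the same kind, so their product converges as well, and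
    the two limits multiply to 1. *)
Lemma infinite_product_neq0 (b : nat -> C) (B r : R) : 0 <= r < 1 -> 0 <= B ->
  (forall k, modulus (b k - 1) <= B * r ^+ k) -> (forall k, b k != 0) ->
  lim ((fun K => \prod_(j < K) b j) @ \oo) != 0.
Proof.
move=> r01 B0 bB bN0.
have b1 : b @ \oo --> (1 : C).
  apply/cvg_modulusP => e e0.
  have : geometric B r @ \oo --> 0.
    by apply: cvg_geometric; case/andP: r01 => r0 r1; rewrite ger0_norm.
  move=> /cvgrPdist_lt /(_ e e0); apply: filterS => n; rewrite sub0r normrN.
  by move=> lte; rewrite modulusB (le_lt_trans (bB n)) // (le_lt_trans (ler_norm _)).
(* The reciprocals converge, hence are bounded; [D * B] then serves as the constant for the
   reciprocal product. *)
have [D D0 bVD] : exists2 D, 0 <= D & forall k, modulus (b k)^-1 <= D.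
  have : cvgn (fun k => (b k)^-1).
    by apply: is_cvgV; [rewrite (cvg_lim _ b1) ?oner_eq0 //;
      exact: norm_hausdorff | apply/cvg_ex; exists 1].
  move=> /cvg_seq_bounded /pinfty_ex_gt0 [M M0 bM].
  have ReM : forall k, modulus (b k)^-1 <= complex.Re M.
    by move=> k; have := bM k I; rewrite /= normE lecE => /andP[].
  exists (complex.Re M) => //; exact: le_trans (modulus_ge0 _) (ReM 0%N).
have bVB k : modulus ((b k)^-1 - 1) <= D * B * r ^+ k.
  have -> : (b k)^-1 - 1 = (b k)^-1 * (1 - b k) by rewrite mulrBr mulr1 mulVf.
  by rewrite modulusM -mulrA modulusB ler_pM ?modulus_ge0.
have c1 := @infinite_product_cvg _ _ _ r01 B0 bB.
have c2 := @infinite_product_cvg _ _ _ r01 (mulr_ge0 D0 B0) bVB.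
apply/eqP => lim0; have := cvgM c1 c2; rewrite lim0 mul0r.
rewrite [_ \* _](_ : _ = cst 1); last first.
  apply/funext => K /=; rewrite -big_split /= big1 // => j _.
  by rewrite mulfV.
move=> c0.
have c10 : (1 : C) = 0.
  by apply: (cvg_unique (@norm_hausdorff _ (CC R)) (cvg_cst (1 : C)) (c0 _)).
by move/eqP: c10; rewrite oner_eq0.
Qed.

End Products.

(** * The Pochhammer product (w; p) and its first-order estimate *)

Section Qpochhammer.
Variables (R : realType) (p : CC R).
Hypothesis p_lt1 : modulus p < 1.
Notation C := (CC R).

Definition qpoch_partial (K : nat) (w : C) : C := \prod_(j < K) (1 - w * p ^+ j).

Definition qpoch (w : C) : C := lim ((fun K => qpoch_partial K w) @ \oo).

Let p01 : 0 <= modulus p < 1. Proof. by rewrite modulus_ge0. Qed.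

Let factorB (w : C) (A : R) : modulus w <= A ->
  forall k, modulus (1 - w * p ^+ k - 1) <= A * modulus p ^+ k.
Proof.
move=> wA k; rewrite addrAC subrr add0r modulusN modulusM modulusX.
by rewrite ler_wpM2r // exprn_ge0 // modulus_ge0.
Qed.

Lemma qpoch_partial_le K (w : C) (A : R) :
  modulus w <= A -> modulus (qpoch_partial K w) <= expR (A / (1 - modulus p)).
Proof.
move=> wA; apply: (@modulus_prod_le _ (fun k => 1 - w * p ^+ k)) => //.
- exact: le_trans (modulus_ge0 _) wA.
- exact: factorB.
Qed.

Lemma qpoch_partial_cvg (w : C) : qpoch_partial K w @[K --> \oo] --> qpoch w.
Proof.
apply: (@infinite_product_cvg _ (fun k => 1 - w * p ^+ k) (modulus w) (modulus p)) => //.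
- exact: modulus_ge0.
- exact: factorB.
Qed.

(** The bound is proportional to [modulus w] with a constant depending only on [A]: at an argument
    such as [w * q ^+ K] it decays geometrically in [K]. *)
Lemma qpoch_partial_near1 K (w : C) (A : R) : modulus w <= A ->
  modulus (qpoch_partial K w - 1) <= modulus w * (expR (A / (1 - modulus p)) / (1 - modulus p)).
Proof.
move=> wA.
have : modulus (qpoch_partial K w - 1) <=
    modulus w * (expR (A / (1 - modulus p)) * \sum_(j < K) modulus p ^+ j).
  elim: K => [|K IHK]; first by rewrite /qpoch_partial !big_ord0 subrr modulus0 !mulr0.
  have -> : qpoch_partial K.+1 w - 1 =
      (qpoch_partial K w - 1) + - (w * (qpoch_partial K w * p ^+ K)).
    by rewrite /qpoch_partial big_ord_recr /=; ring.
  rewrite big_ord_recr /= mulrDr mulrDr (le_trans (modulusD _ _)) // lerD //.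
  rewrite modulusN !modulusM ler_wpM2l ?modulus_ge0 // modulusX.
  by rewrite ler_wpM2r ?qpoch_partial_le // exprn_ge0 // modulus_ge0.
move=> /le_trans; apply; rewrite ler_wpM2l ?modulus_ge0 // ler_wpM2l ?expR_ge0 //.
exact: geometric_sum_le.
Qed.

Lemma qpochS (w : C) : qpoch w = (1 - w) * qpoch (p * w).
Proof.
apply: (@cvg_lim _ (@norm_hausdorff _ _)); rewrite -(cvg_shiftS (fun K => qpoch_partial K w)).
have -> : (fun K => qpoch_partial K.+1 w) =
    (fun K => (1 - w) * qpoch_partial K (p * w)).
  apply/funext => K; rewrite /qpoch_partial big_ord_recl expr0 mulr1.
  by congr (_ * _); apply: eq_bigr => j _; rewrite /= /bump leq0n add1n exprS mulrCA mulrA.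
by apply: cvgMr; exact: qpoch_partial_cvg.
Qed.

End Qpochhammer.

(** * Holomorphy of the Pochhammer product; the theta function *)

Section QpochDiff.
Variables (R : realType) (p : CC R).
Hypothesis p_lt1 : modulus p < 1.
Notation C := (CC R).

Lemma modulus_lim_le (u : nat -> C) (l : C) (M : R) :
  u @ \oo --> l -> (forall k, modulus (u k) <= M) -> modulus l <= M.
Proof.
move=> /cvg_modulusP ul uM; apply/ler_addgt0Pr => e e0.
have [n _ /(_ n (leqnn n)) /= nle] := ul e e0.
rewrite -[l](subrK (u n)) (le_trans (modulusD _ _)) // addrC lerD //.
exact: ltW.
Qed.

Lemma quadratic_remainder_differentiable (f : C -> C) (x D : C) (M : R) :
  (forall h, modulus h <= 1 ->
     modulus (f (x + h) - f x - h * D) <= modulus h ^+ 2 * M) ->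
  differentiable f x.
Proof.
move=> fB; apply/derivable1_diffP; apply/cvg_ex; exists D.
apply/cvg_modulusP => e e0.
have M0 : 0 <= M.
  have := fB 1; rewrite modulus1 lexx expr1n !mul1r => /(_ isT).
  apply: le_trans; exact: modulus_ge0.
(* The 1 keeps [h] in the range of the hypothesis, and [M + 1] avoids dividing by zero when [M] is
   0. *)
pose d := Num.min 1 (e / (M + 1)).
have d0 : 0 < d by rewrite lt_min ltr01 divr_gt0 // ltr_wpDl.
have : \forall h \near 0^', modulus h < d /\ h != 0 :> C.
  exists d%:C%C; first by rewrite /= ltcR.
  by move=> h /=; rewrite sub0r normrN normE ltcR.
apply: filterS => h [hd hN0]; rewrite -modulusN opprB.
have h0 : 0 < modulus h by rewrite modulus_gt0.
have -> : h^-1 *: (f (h *: 1 + x) - f x) - D = h^-1 * (f (x + h) - f x - h * D).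
  by rewrite mulrBr mulKf // addrC [h *: 1]mulr1 addrC [x + h]addrC.
move: hd; rewrite lt_min => /andP[h1 he].
rewrite modulusM modulusV mulrC ltr_pdivrMr //.
apply: (le_lt_trans (fB h (ltW h1))); rewrite expr2 -mulrA mulrC ltr_pM2r //.
move: he; rewrite ltr_pdivlMr ?ltr_wpDl //; apply: le_lt_trans.
by rewrite ler_pM2l // lerDl.
Qed.

Let p01 : 0 <= modulus p < 1. Proof. by rewrite modulus_ge0. Qed.

(* The partial products satisfy a second-order Taylor estimate whose constant is
   uniform in K (it is dominated by a product in moduli), so it survives K -> oo. *)
Lemma qpoch_differentiable (w : C) : differentiable (qpoch p) w.
Proof.
(* Of the 2, one unit covers [modulus h <= 1], the other absorbs the term [h ^+ 2 * (p ^+ K * D K)]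
   that each new factor adds to the remainder. *)
pose A := modulus w + 2.
have A0 : 0 <= A by rewrite addr_ge0 // modulus_ge0.
pose E K := expR (A * \sum_(j < K) modulus p ^+ j).
have EB K : E K <= expR (A / (1 - modulus p)).
  by rewrite ler_expR ler_wpM2l // geometric_sum_le.
have ES K : E K * (1 + A * modulus p ^+ K) <= E K.+1.
  by rewrite /E big_ord_recr /= [in leRHS]mulrDr expRD ler_wpM2l ?expR_ge0 ?expR_ge1Dx.
have E0 K : 0 <= E K by exact: expR_ge0.
have pK0 K : 0 <= modulus p ^+ K by rewrite exprn_ge0 // modulus_ge0.
pose f K := qpoch_partial p K w.
(* The derivative at [w] of the K-th partial product, by the product rule. *)
pose D := fix D K : C := if K is K.+1 then D K * (1 - w * p ^+ K) - p ^+ K * f K else 0.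
have w0 := modulus_ge0 w.
have factor K : modulus (1 - w * p ^+ K) <= 1 + modulus w * modulus p ^+ K.
  by rewrite (le_trans (modulusD _ _)) // modulus1 modulusN modulusM modulusX.
have fB K : modulus (f K) <= E K.
  elim: K => [|K IHK]; first by rewrite /f /qpoch_partial /E !big_ord0 mulr0 expR0 modulus1.
  apply: le_trans (ES K); rewrite /f /qpoch_partial big_ord_recr /= modulusM.
  rewrite ler_pM ?modulus_ge0 //; apply: (le_trans (factor K)).
  by rewrite lerD2l ler_wpM2r // lerDl.
have DB K : modulus (D K) <= E K.
  elim: K => [|K IHK]; first by rewrite modulus0 E0.
  apply: le_trans (ES K); rewrite /= (le_trans (modulusD _ _)) // modulusN !modulusM modulusX.
  have -> : 1 + A * modulus p ^+ K =
    (1 + modulus w * modulus p ^+ K) + 2 * modulus p ^+ K by rewrite /A; ring.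
  rewrite [leRHS]mulrDr; apply: lerD; first by rewrite ler_pM ?modulus_ge0.
  rewrite [leRHS]mulrA [leRHS]mulrC ler_wpM2l //.
  by apply: (le_trans (fB K)); rewrite ler_peMr // ler1n.
have remB K h : modulus h <= 1 ->
    modulus (qpoch_partial p K (w + h) - f K - h * D K) <= modulus h ^+ 2 * E K.
  move=> h1; elim: K => [|K IHK].
    by rewrite /f /qpoch_partial !big_ord0 subrr mulr0 subrr modulus0 mulr_ge0 ?sqr_ge0.
  apply: (@le_trans _ _ (modulus h ^+ 2 * (E K * (1 + A * modulus p ^+ K)))); last first.
    by rewrite ler_wpM2l ?sqr_ge0.
  have -> : qpoch_partial p K.+1 (w + h) - f K.+1 - h * D K.+1 =
      (qpoch_partial p K (w + h) - f K - h * D K) * (1 - (w + h) * p ^+ K)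
      - h ^+ 2 * (p ^+ K * D K).
    have fS v : qpoch_partial p K.+1 v = qpoch_partial p K v * (1 - v * p ^+ K).
      by rewrite /qpoch_partial big_ord_recr.
    have -> : D K.+1 = D K * (1 - w * p ^+ K) - p ^+ K * f K by [].
    by rewrite /f !fS; ring.
  rewrite (le_trans (modulusD _ _)) // modulusN !modulusM !modulusX.
  have -> : modulus h ^+ 2 * (E K * (1 + A * modulus p ^+ K)) =
      modulus h ^+ 2 * E K * (1 + (modulus w + 1) * modulus p ^+ K) +
      modulus h ^+ 2 * (modulus p ^+ K * E K) by rewrite /A; ring.
  rewrite lerD ?ler_pM ?mulr_ge0 ?modulus_ge0 ?sqr_ge0 //.
  rewrite (le_trans (modulusD _ _)) // modulus1 modulusN modulusM modulusX.
  by rewrite lerD2l ler_wpM2r // (le_trans (modulusD _ _)) // lerD2l.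
have cD : cvgn D.
  apply: (@geometric_increments_cvg _ _ ((modulus w + 1) * expR (A / (1 - modulus p)))
    (modulus p)) => // K.
  have -> : D K.+1 - D K = - ((w * D K + f K) * p ^+ K) by rewrite /=; ring.
  rewrite modulusN modulusM modulusX ler_wpM2r // (le_trans (modulusD _ _)) // modulusM
    mulrDl mul1r.
  by rewrite lerD ?ler_wpM2l // (le_trans _ (EB K)).
apply: (@quadratic_remainder_differentiable _ _ (lim (D @ \oo)) (expR (A / (1 - modulus p))))
  => h h1.
apply: (@modulus_lim_le (fun K => qpoch_partial p K (w + h) - f K - h * D K)); last first.
  by move=> K; apply: (le_trans (remB K h h1)); rewrite ler_wpM2l ?sqr_ge0.
by apply: cvgB; [apply: cvgB; exact: qpoch_partial_cvg | apply: cvgMr].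
Qed.

Definition theta (w : C) : C := qpoch p w * qpoch p (p / w).

Hypothesis p_neq0 : p != 0.

Lemma theta_shift (w : C) : w != 0 -> theta (p * w) = (- w)^-1 * theta w.
Proof.
move=> w0; rewrite /theta [qpoch p w](qpochS p_lt1).
have -> : p / (p * w) = w^-1 by rewrite invfM mulrA divff // mul1r.
rewrite [qpoch p w^-1](qpochS p_lt1) invrN.
suff -> : 1 - w^-1 = - w^-1 * (1 - w) by ring.
by rewrite mulrBr mulr1 mulNr mulVf // opprK addrC.
Qed.

End QpochDiff.

(** * The double Pochhammer product and the elliptic gamma function *)

Section Gamma.
Variables (R : realType) (p q : CC R).
Hypotheses (p_lt1 : modulus p < 1) (q_lt1 : modulus q < 1).
Hypotheses (p_neq0 : p != 0) (q_neq0 : q != 0).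
Notation C := (CC R).

Definition dpoch_partial (K : nat) (w : C) : C :=
  \prod_(j < K) \prod_(k < K) (1 - w * p ^+ j * q ^+ k).

Definition dpoch (w : C) : C := lim ((fun K => dpoch_partial K w) @ \oo).

(* The factors with max(j, k) = K. *)
Definition shell (w : C) (K : nat) : C :=
  qpoch_partial p K.+1 (w * q ^+ K) * qpoch_partial q K (w * p ^+ K).

Lemma dpoch_partialS K w : dpoch_partial K.+1 w = dpoch_partial K w * shell w K.
Proof.
rewrite /dpoch_partial; under eq_bigr do rewrite big_ord_recr /=.
rewrite big_split /= big_ord_recr /= -mulrA; congr (_ * _).
rewrite mulrC; congr (_ * _).
by apply: eq_bigr => j _; rewrite mulrAC.
Qed.

(** Peeling the squares into L-shaped shells makes the double product a single one, so the
    convergence and nonvanishing lemmas for sequences apply. *)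
Lemma dpoch_partial_prod w : (fun K => dpoch_partial K w) = (fun K => \prod_(j < K) shell w j).
Proof.
apply/funext; elim=> [|K IHK]; first by rewrite /dpoch_partial !big_ord0.
by rewrite dpoch_partialS IHK big_ord_recr.
Qed.

(** With r the larger of |p| and |q|, both factors of a shell have arguments of size at most |w|
    r^K, and [qpoch_partial_near1] applies to each. *)
Lemma shell_near1 w : exists B r : R, [/\ 0 <= r < 1, 0 <= B &
  forall K, modulus (shell w K - 1) <= B * r ^+ K].
Proof.
pose r := Num.max (modulus p) (modulus q).
have r0 : 0 <= r by rewrite le_max modulus_ge0.
have r1 : r < 1 by rewrite gt_max p_lt1.
have pr K : modulus p ^+ K <= r ^+ K by rewrite lerXn2r ?nnegrE ?modulus_ge0 // le_max lexx.
have qr K : modulus q ^+ K <= r ^+ K by rewrite lerXn2r ?nnegrE ?modulus_ge0 // le_max lexx orbT.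
pose A := modulus w.
have A0 : 0 <= A by exact: modulus_ge0.
have ub (s : C) K : modulus s < 1 -> modulus (w * s ^+ K) <= A.
  move=> s1; rewrite modulusM modulusX ler_piMr // exprn_ile1 ?modulus_ge0 //; exact: ltW.
pose ep := expR (A / (1 - modulus p)); pose eq := expR (A / (1 - modulus q)).
have ep0 : 0 <= ep by exact: expR_ge0.
have eq0 : 0 <= eq by exact: expR_ge0.
have ip0 : 0 <= ep / (1 - modulus p) by rewrite divr_ge0 // subr_ge0 ltW.
have iq0 : 0 <= eq / (1 - modulus q) by rewrite divr_ge0 // subr_ge0 ltW.
exists (A * (ep / (1 - modulus p)) * eq + A * (eq / (1 - modulus q))), r.
split => [||K]; first by rewrite r0 r1.
  exact: addr_ge0 (mulr_ge0 (mulr_ge0 A0 ip0) eq0) (mulr_ge0 A0 iq0).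
have -> : shell w K - 1 =
    (qpoch_partial p K.+1 (w * q ^+ K) - 1) * qpoch_partial q K (w * p ^+ K)
    + (qpoch_partial q K (w * p ^+ K) - 1) by rewrite /shell; ring.
rewrite (le_trans (modulusD _ _)) // modulusM mulrDl lerD //.
  rewrite [leRHS]mulrAC ler_pM ?modulus_ge0 //; last first.
    exact: (qpoch_partial_le q_lt1 _ (ub p K p_lt1)).
  apply: (le_trans (qpoch_partial_near1 p_lt1 _ (ub q K q_lt1))).
  by rewrite modulusM modulusX mulrAC ler_wpM2l ?(mulr_ge0 A0).
apply: (le_trans (qpoch_partial_near1 q_lt1 _ (ub p K p_lt1))).
by rewrite modulusM modulusX mulrAC ler_wpM2l ?(mulr_ge0 A0).
Qed.

Lemma dpoch_partial_cvg w : dpoch_partial K w @[K --> \oo] --> dpoch w.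
Proof.
have [B [r [r01 B0 sB]]] := shell_near1 w.
by have := infinite_product_cvg r01 B0 sB; rewrite -dpoch_partial_prod.
Qed.

Definition zero_free (w : C) := forall j k, w * p ^+ j * q ^+ k != 1.

Lemma dpoch_neq0 w : zero_free w -> dpoch w != 0.
Proof.
have [B [r [r01 B0 sB]]] := shell_near1 w.
move=> wN; rewrite /dpoch dpoch_partial_prod; apply: (infinite_product_neq0 r01 B0 sB) => K.
have wN0 j k : 1 - w * p ^+ j * q ^+ k != 0 by rewrite subr_eq0 eq_sym.
rewrite mulf_neq0 //; apply/prodf_neq0 => j _; last exact: wN0.
by rewrite mulrAC.
Qed.

(** On a K by K square the shift moves k by one: the column k = 0 is the Pochhammer product in [w],
    and the surplus column k = K, with argument [w * q ^+ K], tends to 1. *)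
Lemma dpoch_shift w : dpoch (q * w) * qpoch p w = dpoch w.
Proof.
have partial K : dpoch_partial K (q * w) * qpoch_partial p K w =
    dpoch_partial K w * qpoch_partial p K (w * q ^+ K).
  rewrite /dpoch_partial /qpoch_partial -!big_split /=; apply: eq_bigr => j _.
  have -> : 1 - w * q ^+ K * p ^+ j = 1 - w * p ^+ j * q ^+ K by ring.
  rewrite -(big_ord_recr K (fun k => 1 - w * p ^+ j * q ^+ k)) big_ord_recl /=.
  rewrite expr0 mulr1 mulrC; congr (_ * _); apply: eq_bigr => k _.
  by rewrite /bump leq0n add1n exprS; ring.
have to1 : qpoch_partial p K (w * q ^+ K) @[K --> \oo] --> (1 : C).
  apply/cvg_modulusP => e e0.
  pose M := expR (modulus w / (1 - modulus p)) / (1 - modulus p).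
  have : geometric (modulus w * M) (modulus q) @ \oo --> (0 : R).
    by apply: cvg_geometric; rewrite ger0_norm ?modulus_ge0.
  move=> /cvgrPdist_lt /(_ e e0); apply: filterS => K; rewrite sub0r normrN.
  move=> lte; rewrite modulusB; apply: le_lt_trans lte.
  apply: le_trans (ler_norm _); rewrite /= mulrAC -modulusX -modulusM.
  apply: (qpoch_partial_near1 p_lt1); rewrite modulusM modulusX.
  by rewrite ler_piMr ?modulus_ge0 // exprn_ile1 ?modulus_ge0 // ltW.
have c1 : dpoch_partial K (q * w) * qpoch_partial p K w @[K --> \oo] --> dpoch (q * w) *
  qpoch p w.
  by apply: cvgM; [exact: dpoch_partial_cvg | exact: qpoch_partial_cvg].
have c2 : dpoch_partial K w * qpoch_partial p K (w * q ^+ K) @[K --> \oo] --> dpoch w * 1.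
  by apply: cvgM; [exact: dpoch_partial_cvg | exact: to1].
rewrite -[RHS]mulr1; apply: (cvg_unique (@norm_hausdorff _ (CC R)) c1).
by rewrite (_ : (fun K => _) = (fun K =>
  dpoch_partial K w * qpoch_partial p K (w * q ^+ K))) //; apply/funext.
Qed.

(** [ellGamma] is a limit of quotients; it is the quotient of the limits once the limit of the
    denominators is nonzero. *)
Lemma ellGammaE z : zero_free z -> ellGamma p q z = dpoch (p * q / z) / dpoch z.
Proof.
move=> zN; apply: (@cvg_lim _ (@norm_hausdorff _ _)).
rewrite (_ : (fun K => _) = (fun K => dpoch_partial K (p * q / z) * (dpoch_partial K z)^-1));
  last first.
  apply/funext => K; rewrite /dpoch_partial -prodfV -big_split /=; apply: eq_bigr => j _.
  rewrite -prodfV -big_split /=; apply: eq_bigr => k _; congr ((1 - _) * _).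
  by rewrite !exprS; ring.
apply: cvgM; first exact: dpoch_partial_cvg.
by apply: cvgV; [exact: dpoch_neq0 | exact: dpoch_partial_cvg].
Qed.

(** The first condition excludes poles and the second zeros; z -> pq/z exchanges them. *)
Definition gamma_regular (z : C) := zero_free z /\ zero_free (p * q / z).

Lemma ellGamma_neq0 z : gamma_regular z -> ellGamma p q z != 0.
Proof. by move=> [z1 z2]; rewrite ellGammaE // mulf_neq0 ?invr_eq0 ?dpoch_neq0. Qed.

(** [dpoch_shift] at [z] and at [p / z] yields the two halves of theta. *)
Lemma ellGamma_shift z : z != 0 -> gamma_regular z -> gamma_regular (q * z) ->
  ellGamma p q (q * z) = theta p z * ellGamma p q z.
Proof.
move=> z0 [z1 z2] [z3 z4]; rewrite !ellGammaE // /theta.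
have -> : p * q / (q * z) = p / z by rewrite invfM mulrA mulfK.
rewrite -(dpoch_shift z) -(dpoch_shift (p / z)).
have -> : q * (p / z) = p * q / z by ring.
have d0 : dpoch (q * z) != 0 by exact: dpoch_neq0.
have : dpoch (q * z) * qpoch p z != 0 by rewrite dpoch_shift dpoch_neq0.
rewrite mulf_eq0 negb_or => /andP[_ th0].
by field; rewrite th0.
Qed.


Lemma theta_neq0 z : z != 0 -> gamma_regular z -> gamma_regular (q * z) -> theta p z != 0.
Proof.
move=> z0 rz rqz; have := ellGamma_neq0 rqz.
by rewrite ellGamma_shift // mulf_eq0 negb_or => /andP[].
Qed.

End Gamma.

(** * Monomials and generic points *)

Section Monomial.
Variables (F : fieldType) (I : finType).
Implicit Types (X : I -> F) (v w : {ffun I -> int}).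

Definition monomial X v : F := \prod_i X i ^ v i.

Lemma monomial0 X : monomial X 0 = 1.
Proof. by rewrite /monomial big1 // => i _; rewrite ffunE expr0z. Qed.

Lemma monomialD X v w : (forall i, X i != 0) ->
  monomial X (v + w) = monomial X v * monomial X w.
Proof.
move=> X0; rewrite -big_split; apply: eq_bigr => i _.
by rewrite ffunE expfzDr.
Qed.

Lemma monomialN X v : monomial X (- v) = (monomial X v)^-1.
Proof.
rewrite /monomial -prodfV; apply: eq_bigr => i _.
by rewrite ffunE -invr_expz.
Qed.

Lemma monomialMz X v (n : int) : monomial X (v *~ n) = monomial X v ^ n.
Proof.
rewrite /monomial.
have -> : (\prod_i X i ^ v i) ^ n = \prod_i (X i ^ v i) ^ n.
  by elim/big_rec2: _ => [|i y z _ <-]; rewrite ?exp1rz // expfzMl.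
by apply: eq_bigr => i _; rewrite ffunMzE exprz_exp mulrzz.
Qed.

Lemma monomial_neq0 X v : (forall i, X i != 0) -> monomial X v != 0.
Proof. by move=> X0; apply/prodf_neq0 => i _; exact: expfz_neq0. Qed.

Definition delta_ffun (i : I) : {ffun I -> int} := [ffun j => (j == i)%:Z].

Lemma monomial_delta X i : monomial X (delta_ffun i) = X i.
Proof.
rewrite /monomial (bigD1 i) //= ffunE eqxx expr1z big1 ?mulr1 // => j /negPf ji.
by rewrite ffunE ji expr0z.
Qed.

Lemma monomial_sum X (J : Type) (r : seq J) (P : pred J) (v : J -> {ffun I -> int}) :
  (forall i, X i != 0) ->
  monomial X (\sum_(j <- r | P j) v j) = \prod_(j <- r | P j) monomial X (v j).
Proof.
move=> X0; elim/big_rec2: _ => [|j y z _ <-]; first exact: monomial0.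
exact: monomialD.
Qed.

Definition scale_coord (b : I) (c : F) X (i : I) : F := if i == b then c * X i else X i.

Lemma monomial_scale b c X v : monomial (scale_coord b c X) v = c ^ v b * monomial X v.
Proof.
rewrite /monomial /scale_coord (bigD1 b) //= eqxx [in RHS](bigD1 b) //=.
rewrite expfzMl -mulrA; congr (_ * (_ * _)).
by apply: eq_bigr => i /negPf ->.
Qed.

End Monomial.

(** * The domain of (x, q) and sets that are generic in every slice *)

Section Domain.
Variables (R : realType) (N : nat).
Notation C := (CC R).
Notation T := ('rV[C]_N * C)%type.
Notation expo := {ffun option (option 'I_N) -> int}.

(** With p among the coordinates, the multipliers of theta under p-shifts are again signed
    monomials; with q among them, the shift of q is handled like that of any variable. *)
Definition coords (p q : C) (x : 'rV[C]_N) (c : option (option 'I_N)) : C :=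
  match c with None => p | Some None => q | Some (Some i) => x 0 i end.

Definition disc : set C := [set q | 0 < `|q| < 1].

Definition domain : set T := [set u | ctorus u.1 /\ disc u.2].

Lemma discP (q : C) : disc q <-> q != 0 /\ modulus q < 1.
Proof.
rewrite /disc /= normE -normE normr_gt0 normE -[1]/(1%:C%C) ltcR.
by split => [/andP[]|[-> ->]].
Qed.

Lemma fst_differentiable (u : T) : differentiable (fun u : T => u.1) u.
Proof. by apply: (@linear_differentiable _ _ _ fst); move=> [x q]; exact: cvg_fst. Qed.

Lemma snd_differentiable (u : T) : differentiable (fun u : T => u.2) u.
Proof. by apply: (@linear_differentiable _ _ _ snd); move=> [x q]; exact: cvg_snd. Qed.

Lemma differentiable_exprz (V : normedModType C) (f : V -> C) (n : int) (u : V) :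
  differentiable f u -> f u != 0 -> differentiable (fun u => f u ^ n) u.
Proof.
have dX (g : V -> C) k : differentiable g u -> differentiable (fun u => g u ^+ k) u.
  move=> dg; elim: k => [|k IHk]; first by apply: differentiable_cst.
  rewrite (_ : (fun u => _) = g * (fun u => g u ^+ k)); first exact: differentiableM.
  by apply/funext => y; rewrite exprS.
move=> df f0; case: n => k /=; first exact: dX.
by apply: differentiableV; [exact: dX | rewrite expf_neq0].
Qed.

Lemma differentiable_prod (V : normedModType C) (J : Type) (r : seq J) (P : pred J)
    (f : J -> V -> C) (u : V) :
  (forall j, P j -> differentiable (f j) u) ->
  differentiable (fun u => \prod_(j <- r | P j) f j u) u.
Proof.
move=> df; elim: r => [|j r IHr].
  rewrite (_ : (fun u => _) = cst 1) ?funeqE => [|y]; last by rewrite big_nil.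
  exact: differentiable_cst.
case Pj : (P j).
  rewrite (_ : (fun u => _) = f j * (fun u => \prod_(j <- r | P j) f j u)) ?funeqE => [|y].
    by apply: differentiableM => //; exact: df.
  by rewrite big_cons Pj.
by rewrite (_ : (fun u => _) = (fun u => \prod_(j <- r | P j) f j u)) ?funeqE => [//|y];
  rewrite big_cons Pj.
Qed.

Lemma coords_neq0 (p : C) (u : T) : p != 0 -> domain u -> forall c, coords p u.2 u.1 c != 0.
Proof. by move=> p0 [u1 /discP[u2 _]] [[i|]|] /=. Qed.

Lemma monomial_differentiable (p : C) (v : expo) (u : T) : p != 0 -> domain u ->
  differentiable (fun u : T => monomial (coords p u.2 u.1) v) u.
Proof.
move=> p0 Du; apply: differentiable_prod => c _.
apply: differentiable_exprz; last exact: coords_neq0.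
case: c => [[i|]|] /=.
- apply: (@differentiable_comp _ _ _ _ (fun u : T => u.1) (fun x : 'rV[C]_N => x 0 i)).
    exact: fst_differentiable.
  exact: differentiable_coord.
- exact: snd_differentiable.
- exact: differentiable_cst.
Qed.

Lemma domain_open : open domain.
Proof.
rewrite openE => -[x q] [/= x0 q01].
have cx i : {for (x, q), continuous (fun u : T => u.1 0 i)}.
  apply: differentiable_continuous.
  apply: (@differentiable_comp _ _ _ _ (fun u : T => u.1) (fun x : 'rV[C]_N => x 0 i)).
    exact: fst_differentiable.
  exact: differentiable_coord.
have cq : {for (x, q), continuous (fun u : T => u.2)}.
  by apply: differentiable_continuous; exact: snd_differentiable.
have [q0 q1] := (discP q).1 q01.
have n1 : \forall u \near nbhs ((x, q) : T), forall i, (u : T).1 0 i != 0.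
  by apply: filter_forall => i; apply: (cvgr_neq0 _ (cx i)); exact: x0.
have n2 : \forall u \near nbhs ((x, q) : T), u.2 != 0 by apply: (cvgr_neq0 _ cq).
have n3 : \forall u \near nbhs ((x, q) : T), modulus (q - u.2) < 1 - modulus q.
  by move/cvg_modulusP: cq; apply; rewrite subr_gt0.
near=> u; split; first by near: u; exact: n1.
apply/discP; split; first by near: u; exact: n2.
rewrite -[u.2](subrK q) (le_lt_trans (modulusD _ _)) // -ltrBrDr modulusB.
by near: u; exact: n3.
Unshelve. all: by end_near. Qed.

(* P holds on an open set that is dense jointly in (x, q) and on every slice of
   fixed q; for such sets, finite intersections stay of the same kind. *)
Definition fgeneric (P : C -> 'rV[C]_N -> Prop) := exists W : set T,
  [/\ open W, W `<=` domain,
      forall q, disc q -> @ctorus R N `<=` closure [set x | W (x, q)]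
    & forall x q, W (x, q) -> P q x].

Lemma slice_differentiable (q : C) (x : 'rV[C]_N) :
  differentiable (fun x : 'rV[C]_N => (x, q) : T) x.
Proof.
apply: (@differentiable_pair _ _ _ _ id (cst q)); last exact: differentiable_cst.
by have := is_diff_id x; case.
Qed.

Lemma slice_continuous (q : C) : continuous (fun x : 'rV[C]_N => (x, q) : T).
Proof. by move=> x; apply: differentiable_continuous; exact: slice_differentiable. Qed.

Lemma slice_open (W : set T) q : open W -> open [set x | W (x, q)].
Proof.
move=> oO; rewrite openE => x /= Ox; apply: (@slice_continuous q x).
exact: open_nbhs_nbhs.
Qed.

Lemma fgenericW P Q : fgeneric P ->
  (forall x q, domain (x, q) -> P q x -> Q q x) -> fgeneric Q.
Proof.
move=> [W [oO OD Ocl OP]] PQ; exists W; split => // x q Oxq.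
by apply: PQ; [exact: OD | exact: OP].
Qed.

Lemma fgenericT (P : C -> 'rV[C]_N -> Prop) :
  (forall x q, domain (x, q) -> P q x) -> fgeneric P.
Proof.
move=> HP; exists domain; split => //; first exact: domain_open.
by move=> q q01; apply: subset_trans (@subset_closure _ _) => x x0.
Qed.

Lemma fgenericI P Q : fgeneric P -> fgeneric Q ->
  fgeneric (fun q x => P q x /\ Q q x).
Proof.
move=> [W1 [oO1 O1D O1cl O1P]] [W2 [oO2 O2D O2cl O2Q]].
exists (W1 `&` W2); split.
- exact: openI.
- by move=> u [/O1D].
- move=> q q01 x x0 A /nbhs_interior Ax.
  have [y [/= O1y Ay]] := O1cl q q01 x x0 _ Ax.
  have y0 : ctorus y by have [] := O1D _ O1y.
  have : nbhs y (A^° `&` [set x | W1 (x, q)]).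
    by apply: open_nbhs_nbhs; split => //; apply: openI;
      [exact: open_interior | exact: slice_open].
  move=> /(O2cl q q01 y y0) [z [/= O2z [Az O1z]]].
  by exists z; split => //; exact: interior_subset.
- by move=> x q [/O1P ? /O2Q].
Qed.

Lemma fgeneric_seq (J : eqType) (s : seq J) (P : J -> C -> 'rV[C]_N -> Prop) :
  (forall j, j \in s -> fgeneric (P j)) ->
  fgeneric (fun q x => forall j, j \in s -> P j q x).
Proof.
elim: s => [|j s IHs] Ps; first by apply: fgenericT.
have P1 := Ps j (mem_head _ _).
have P2 : fgeneric (fun q x => forall j, j \in s -> P j q x).
  by apply: IHs => k ks; apply: Ps; rewrite inE ks orbT.
apply: fgenericW (fgenericI P1 P2) _ => x q _ [Pj Pjs] k.
by rewrite inE => /predU1P[->//|]; exact: Pjs.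
Qed.

Lemma fgeneric_mero_slice (f g : 'rV[C]_N -> C) P q : disc q -> fgeneric P ->
  (forall x, ctorus x -> P q x -> f x = g x) -> mero_eq (@ctorus R N) f g.
Proof.
move=> q01 [W [oO OD Ocl OP]] fg; exists [set x | W (x, q)]; split.
- exact: slice_open.
- by move=> x /OD [].
- exact: Ocl.
- by move=> x /= Ox; apply: fg; [case: (OD _ Ox) | exact: OP].
Qed.

(** A neighbourhood of (x, q) restricts to a neighbourhood of x in the slice at q, so density in
    slices gives joint density. *)
Lemma fgeneric_closure P : fgeneric P ->
  exists W : set T, [/\ open W, W `<=` domain, domain `<=` closure W
     & forall u, W u -> P u.2 u.1].
Proof.
move=> [W [oO OD Ocl OP]]; exists W; split => //; last by case=> x q; exact: OP.
move=> [x q] [/= x0 q01] A Ax.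
have [|y [/= Oy Ay]] := Ocl q q01 x x0 [set x | A (x, q)]; last by exists (y, q).
exact: (@slice_continuous q x).
Qed.

End Domain.

(** * Degenerate Gamma arguments are closed and nowhere dense *)

Section ZeroFree.
Variables (R : realType) (N : nat) (p : CC R).
Hypotheses (p_neq0 : p != 0) (p_lt1 : modulus p < 1).
Notation C := (CC R).
Notation T := ('rV[C]_N * C)%type.
Notation expo := {ffun option (option 'I_N) -> int}.
Implicit Types v : expo.

Lemma scale_var_line (i : 'I_N) (c : C) (x : 'rV[C]_N) :
  scale_var i (1 + c) x = x + c *: \row_j (if j == i then x 0 i else 0).
Proof.
apply/rowP => j; rewrite !mxE; case: eqP => [->|_]; last by rewrite mulr0 addr0.
by rewrite mulrDl mul1r.
Qed.

Lemma scale_var_near1 (i : 'I_N) (x : 'rV[C]_N) (A : set 'rV[C]_N) : nbhs x A ->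
  exists2 e : R, 0 < e & forall t : R, 0 < t < e -> A (scale_var i (1 + t%:C%C) x).
Proof.
move=> Ax; pose y : 'rV[C]_N := \row_j (if j == i then x 0 i else 0).
have cx : {for (0 : C), continuous (fun c : C => x + c *: y)}.
  apply: differentiable_continuous; apply: differentiableD.
    exact: differentiable_cst.
  apply: (@differentiableZl _ _ _ id y); by have := is_diff_id (0 : C); case.
have : nbhs (0 : C) (fun c : C => A (x + c *: y)).
  by apply: cx; rewrite /= scale0r addr0.
move=> /nbhs_ballP[[a b]]; rewrite /= ltcE /= => /andP[/eqP -> a0] ballA.
exists a => // t /andP[t0 ta]; rewrite scale_var_line; apply: ballA.
by rewrite /ball /= sub0r normrN normE modulus_real ltcR gtr0_norm.
Qed.

Lemma coords_scale_var (i : 'I_N) (c q : C) (x : 'rV[C]_N) :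
  coords p q (scale_var i c x) = scale_coord (Some (Some i)) c (coords p q x).
Proof. by apply/funext => -[[j|]|] //=; rewrite /scale_coord mxE. Qed.

Lemma monomial_scale_var (i : 'I_N) (c q : C) (x : 'rV[C]_N) v :
  monomial (coords p q (scale_var i c x)) v =
  c ^ v (Some (Some i)) * monomial (coords p q x) v.
Proof. by rewrite coords_scale_var; exact: monomial_scale. Qed.

(** Taking moduli reduces this to injectivity of a nonzero integer power on positive reals. *)
Lemma exprz_real_inj (d : int) (m : C) (t1 t2 : R) : d != 0 -> 0 < t1 -> 0 < t2 ->
  (1 + t1%:C%C) ^ d * m = 1 -> (1 + t2%:C%C) ^ d * m = 1 -> t1 = t2.
Proof.
move=> d0 t10 t20 e1 e2.
have m0 : m != 0.
  by apply/eqP => m0; move/eqP: e1; rewrite m0 mulr0 eq_sym oner_eq0.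
have /(mulIf m0) := etrans e1 (esym e2).
have modz (y : C) n : modulus (y ^ n) = modulus y ^ n.
  by case: n => n; rewrite ?NegzE -?invr_expz ?modulusV /exprz modulusX.
have mod1 (t : R) : 0 < t -> modulus (1 + t%:C%C) = 1 + t.
  move=> t0; have -> : 1 + t%:C%C = (1 + t)%:C%C :> C by rewrite real_complexD.
  by rewrite modulus_real ger0_norm // addr_ge0 // ltW.
have mz (t : R) (t0 : 0 < t) : modulus ((1 + t%:C%C) ^ d) = (1 + t) ^ d.
  by rewrite modz (mod1 t t0).
move=> /(congr1 (@modulus R)) E.
have /(pexpIrz d0) H := etrans (esym (mz t1 t10)) (etrans E (mz t2 t20)).
apply: (addrI 1); apply: H; rewrite nnegrE.
  exact: addr_ge0 ler01 (ltW t10).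
exact: addr_ge0 ler01 (ltW t20).
Qed.

(* Rescaling x_i by 1 + t moves the monomial along a curve that meets each of the
   countably many forbidden values at most once. *)
Lemma zero_free_dense (i : 'I_N) (q : C) v : v (Some (Some i)) != 0 ->
  @ctorus R N `<=` closure [set x | ctorus x /\ zero_free p q (monomial (coords p q x) v)].
Proof.
move=> v0 x x0 A Ax; have [e e0 Ae] := scale_var_near1 i Ax.
pose xt (t : R) := scale_var i (1 + t%:C%C) x.
pose bad (jk : nat * nat) : set R := [set t | 0 < t /\
  (1 + t%:C%C) ^ v (Some (Some i)) *
    (monomial (coords p q x) v * (p ^+ jk.1 * q ^+ jk.2)) = 1].
have cbad : countable (\bigcup_jk bad jk).
  apply: bigcup_countable => // jk _; apply: finite_set_countable.
  have [[t bt]|nt] := pselect (exists t, bad jk t).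
    apply: (@sub_finite_set _ _ [set t]); last exact: finite_set1.
    move=> s [s0 bs]; case: bt => t0 bt.
    exact: (exprz_real_inj v0 s0 t0 bs bt).
  rewrite (_ : bad jk = set0) // -subset0 => t bt; apply: nt; by exists t.
(* The interval has positive Lebesgue measure, so the countable bad set cannot cover it. *)
have [t [t0 tb]] : exists t, 0 < t < e /\ ~ (\bigcup_jk bad jk) t.
  apply: contrapT => H.
  have : countable (`]0, e[%classic : set R).
    apply: sub_countable cbad; apply: subset_card_le => t /=; rewrite in_itv /= => te.
    by apply: contrapT => nb; apply: H; exists t.
  move=> /countable_lebesgue_measure0; rewrite lebesgue_measure_itv /= lte_fin e0 sube0.
  by move=> /eqP; rewrite eqe => /eqP ee; move: e0; rewrite ee ltxx.
exists (xt t); split; last exact: Ae.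
split.
  move=> j; rewrite mxE; case: ifP => _; last exact: x0.
  rewrite mulf_neq0 ?x0 //; apply/eqP => /(congr1 (@complex.Re R)) /= /eqP.
  by case/andP: t0 => t0 _; rewrite gt_eqF // addr_gt0.
move=> j k; apply/eqP => E; apply: tb; exists (j, k) => //; split.
  by case/andP: t0.
move: E; rewrite (monomial_scale_var i (1 + t%:C%C) q x v).
by apply: etrans; rewrite -!mulrA.
Qed.

(* Only finitely many (j, k) can give the value 1 near a given point. *)
Lemma zero_free_near v (u0 : T) : domain u0 ->
  zero_free p u0.2 (monomial (coords p u0.2 u0.1) v) ->
  \forall u \near u0, zero_free p u.2 (monomial (coords p u.2 u.1) v).
Proof.
move=> Du0 z0; pose f (u : T) := monomial (coords p u.2 u.1) v.
have df : differentiable f u0 by exact: monomial_differentiable.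
have dq : differentiable (fun u : T => u.2) u0 by exact: snd_differentiable.
have [q00 q01] := (discP _).1 Du0.2.
(* Near [u0], [A] bounds the monomial and [Q < 1] bounds |q|; once [A * r ^+ K < 1], an index at
   least [K] makes the product smaller than 1 in modulus. *)
pose A := modulus (f u0) + 1; pose Q := (1 + modulus u0.2) / 2.
pose r := Num.max (modulus p) Q.
have Q0 : 0 <= Q by rewrite divr_ge0 // addr_ge0 // modulus_ge0.
have Q1 : Q < 1 by rewrite /Q; lra.
have r0 : 0 <= r by rewrite le_max Q0 orbT.
have r1 : r < 1 by rewrite gt_max p_lt1 Q1.
have A0 : 0 < A by rewrite ltr_wpDl // modulus_ge0.
have [K AK] : exists K, A * r ^+ K < 1.
  have : geometric A r @ \oo --> (0 : R) by apply: cvg_geometric; rewrite ger0_norm.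
  move=> /cvgrPdist_lt /(_ 1 ltr01) [K _ /(_ K (leqnn K))] /=.
  by rewrite sub0r normrN => H; exists K; apply: le_lt_trans H; exact: ler_norm.
have n1 : \forall u \near u0, modulus (f u0 - f u) < 1.
  by have /cvg_modulusP := differentiable_continuous df; apply.
have n2 : \forall u \near u0, modulus (u0.2 - u.2) < (1 - modulus u0.2) / 2.
  have /cvg_modulusP := differentiable_continuous dq; apply.
  by rewrite divr_gt0 // subr_gt0.
have cF (j k : nat) : {for u0, continuous (fun u : T => f u * p ^+ j * u.2 ^+ k - 1)}.
  apply: differentiable_continuous.
  have dX : differentiable (fun u : T => u.2 ^+ k) u0.
    exact: (@differentiable_exprz _ _ _ k _ dq q00).
  apply: (@differentiableB _ _ _ ((f * cst (p ^+ j)) * (fun u : T => u.2 ^+ k)) (cst 1));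
    last exact: differentiable_cst.
  apply: differentiableM; last exact: dX.
  by apply: differentiableM; [exact: df | exact: differentiable_cst].
have n3 : \forall u \near u0, forall jk : 'I_K * 'I_K,
    f (u : T) * p ^+ jk.1 * u.2 ^+ jk.2 - 1 != 0.
  apply: (@filter_forall _ ('I_K * 'I_K)%type
    (fun jk (u : T) => f u * p ^+ jk.1 * u.2 ^+ jk.2 - 1 != 0) (nbhs u0) (nbhs_filter u0)) =>
      -[j k].
  apply: (cvgr_neq0 _ (cF j k)).
  by rewrite subr_eq0; exact: (z0 j k).
near=> u => j k.
have fA : modulus (f u) <= A.
  rewrite -[f u](subrK (f u0)) (le_trans (modulusD _ _)) // addrC lerD2l modulusB.
  by apply: ltW; near: u; exact: n1.
have uQ : modulus u.2 <= Q.
  rewrite -[u.2](subrK u0.2) (le_trans (modulusD _ _)) //.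
  have : modulus (u0.2 - u.2) < (1 - modulus u0.2) / 2 by near: u; exact: n2.
  by rewrite modulusB /Q; lra.
have [jK|jK] := ltnP j K; last first.
  apply/eqP => /(congr1 (@modulus R)); rewrite modulus1 => /eqP; apply/negP.
  rewrite lt_eqF // !modulusM !modulusX.
  apply: le_lt_trans AK; rewrite -mulrA ler_pM ?mulr_ge0 ?exprn_ge0 ?modulus_ge0 //.
  apply: (@le_trans _ _ (modulus p ^+ j)).
    by rewrite ler_piMr ?exprn_ge0 ?modulus_ge0 // exprn_ile1 ?modulus_ge0 // (le_trans uQ)
      // ltW.
  apply: (@le_trans _ _ (r ^+ j)).
    by rewrite lerXn2r ?nnegrE ?modulus_ge0 // le_max lexx.
  by rewrite ler_wiXn2l // ltW.
have [kK|kK] := ltnP k K; last first.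
  apply/eqP => /(congr1 (@modulus R)); rewrite modulus1 => /eqP; apply/negP.
  rewrite lt_eqF // !modulusM !modulusX.
  apply: le_lt_trans AK; rewrite -mulrA ler_pM ?mulr_ge0 ?exprn_ge0 ?modulus_ge0 //.
  apply: (@le_trans _ _ (modulus u.2 ^+ k)).
    by rewrite ler_piMl ?exprn_ge0 ?modulus_ge0 // exprn_ile1 ?modulus_ge0 // ltW.
  apply: (@le_trans _ _ (r ^+ k)).
    by rewrite lerXn2r ?nnegrE ?modulus_ge0 // le_max uQ orbT.
  by rewrite ler_wiXn2l // ltW.
have H : forall jk : 'I_K * 'I_K, f (u : T) * p ^+ jk.1 * u.2 ^+ jk.2 - 1 != 0.
  by near: u; exact: n3.
by have := H (Ordinal jK, Ordinal kK); rewrite subr_eq0.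
Unshelve. all: by end_near. Qed.

Lemma fgeneric_zero_free (i : 'I_N) v : v (Some (Some i)) != 0 ->
  fgeneric (fun q (x : 'rV[C]_N) => zero_free p q (monomial (coords p q x) v)).
Proof.
move=> v0.
exists [set u | domain u /\ zero_free p u.2 (monomial (coords p u.2 u.1) v)]; split.
- rewrite openE => u [Du zu].
  have n1 := zero_free_near Du zu.
  have n2 : \forall u \near u, domain u.
    by apply: open_nbhs_nbhs; split => //; exact: domain_open.
  by near=> y; split; near: y.
- by move=> u [].
- move=> q q01 x x0; have := zero_free_dense q v0 x0.
  by apply: closure_subset => y [y0 yz]; split.
- by move=> x q [].
Unshelve. all: by end_near. Qed.

Lemma fgeneric_gamma_regular (i : 'I_N) v : v (Some (Some i)) != 0 ->
  fgeneric (fun q (x : 'rV[C]_N) => gamma_regular p q (monomial (coords p q x) v)).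
Proof.
move=> v0; pose w : expo := delta_ffun None + delta_ffun (Some None) - v.
have w0 : w (Some (Some i)) != 0 by rewrite !ffunE /= add0r oppr_eq0.
apply: (fgenericW (fgenericI (fgeneric_zero_free v0) (fgeneric_zero_free w0))).
move=> x q Dxq [z1 z2]; split => //.
have c0 : forall c, coords p q x c != 0 by move=> c; exact: (coords_neq0 p_neq0 Dxq).
by move: z2; rewrite !monomialD // monomialN !monomial_delta.
Qed.

End ZeroFree.

(** * Theta products and certificates *)

Section SignedPower.
Variable F : fieldType.

Definition signed_pow (s : bool) (x : F) : F := if s then x^-1 else x.

Definition sgn (s : bool) : int := if s then -1 else 1.

Lemma signed_powE s x : signed_pow s x = x ^ sgn s.
Proof. by case: s; rewrite /= ?expr1z // exprN1. Qed.

Lemma signed_powM s x y : signed_pow s (x * y) = signed_pow s x * signed_pow s y.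
Proof. by case: s; rewrite /= ?invfM. Qed.

Lemma signed_powV s x : signed_pow s x^-1 = (signed_pow s x)^-1.
Proof. by case: s. Qed.

Lemma signed_pow_addb s t x : signed_pow s (signed_pow t x) = signed_pow (s (+) t) x.
Proof. by case: s t => [] [] //=; rewrite invrK. Qed.

Lemma signed_pow_prod s (I : Type) (r : seq I) (P : pred I) (f : I -> F) :
  signed_pow s (\prod_(i <- r | P i) f i) = \prod_(i <- r | P i) signed_pow s (f i).
Proof. by case: s => //=; rewrite -prodfV. Qed.

End SignedPower.

Section Triangular.

Definition tri (B : int) : int := ((B * (B - 1)) %/ 2)%Z.

Lemma tri2 B : tri B * 2 = B * (B - 1).
Proof.
have [k kE] : exists k, B * (B - 1) = k * 2.
  have [->|->] : B = (B %/ 2)%Z * 2 \/ B = (B %/ 2)%Z * 2 + 1 by lia.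
    by exists ((B %/ 2)%Z * ((B %/ 2)%Z * 2 - 1)); ring.
  by exists ((B %/ 2)%Z * ((B %/ 2)%Z * 2 + 1)); ring.
by rewrite /tri kE mulzK.
Qed.

Lemma triS B : tri (B + 1) = tri B + B.
Proof.
have t1 := tri2 B; have t2 := tri2 (B + 1).
have {}t2 : tri (B + 1) * 2 = tri B * 2 + B * 2 by rewrite t1 t2; ring.
by lia.
Qed.

Lemma tri0 : tri 0 = 0. Proof. by []. Qed.

End Triangular.

Section ThetaProduct.
Variables (R : realType) (p : CC R).
Hypotheses (p_neq0 : p != 0) (p_lt1 : modulus p < 1).
Notation C := (CC R).

(** The left side does not change when [B] increases by 1. The exponents of p gathered along the
    way, 0 + 1 + ... + (B - 1), make up [tri B]. *)
Lemma theta_shiftz (w : C) (B : int) : w != 0 ->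
  theta p (p ^ B * w) * ((- w) ^ B * p ^ tri B) = theta p w.
Proof.
move=> w0; have mw0 : - w != 0 by rewrite oppr_eq0.
have step k : theta p (p ^ (k + 1) * w) * ((- w) ^ (k + 1) * p ^ tri (k + 1)) =
    theta p (p ^ k * w) * ((- w) ^ k * p ^ tri k).
  have k0 : p ^ k * w != 0 by rewrite mulf_neq0 // expfz_neq0.
  have -> : p ^ (k + 1) * w = p * (p ^ k * w) by rewrite expfzDr // expr1z; ring.
  rewrite theta_shift // triS (expfzDr k 1 mw0) (expfzDr (tri k) k p_neq0) expr1z.
  have := expfz_neq0 k p_neq0; rewrite -mulrN.
  move: (p ^ k) (p ^ tri k) (theta _ _) ((- w) ^ k) => a b c d a0.
  by field; rewrite a0 w0.
have base : theta p (p ^ 0 * w) * ((- w) ^ 0 * p ^ tri 0) = theta p w.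
  by rewrite tri0 !expr0z !mul1r mulr1.
elim/int_rect: B => [//|n IHn|n IHn].
  by rewrite -IHn -[RHS]step; congr (theta p (p ^ _ * w) * (_ ^ _ * p ^ tri _)); lia.
rewrite -IHn -[LHS]step; congr (theta p (p ^ _ * w) * (_ ^ _ * p ^ tri _)); lia.
Qed.

Variable I : finType.
Notation expo := {ffun I -> int}.
Implicit Types (X : I -> C) (L : seq (bool * expo)).

Definition theta_prod X L : C :=
  \prod_(b <- L) signed_pow b.1 (theta p (monomial X b.2)).

(** The multipliers combine to a sign times one monomial, p being the coordinate [ip]. The first sum
    condition annihilates the exponent vector of that monomial, the parity condition the sign. *)
Lemma theta_prod_scale (ip b : I) X L : X ip = p -> (forall i, X i != 0) ->
  (forall c, \sum_(v <- L) sgn v.1 * (v.2 b * v.2 c + (c == ip)%:Z * tri (v.2 b)) = 0) ->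
  (exists k : int, \sum_(v <- L) sgn v.1 * v.2 b = k * 2) ->
  theta_prod (scale_coord b p X) L = theta_prod X L.
Proof.
move=> Xip X0 Lc [k Lb].
pose m (v : bool * expo) : C := (- monomial X v.2) ^ v.2 b * p ^ tri (v.2 b).
have -> : theta_prod X L =
    theta_prod (scale_coord b p X) L * \prod_(v <- L) signed_pow v.1 (m v).
  rewrite /theta_prod -big_split /=; apply: eq_bigr => v _.
  by rewrite -signed_powM monomial_scale theta_shiftz // monomial_neq0.
rewrite [X in _ * X](_ : _ = 1) ?mulr1 //.
have mE v : signed_pow v.1 (m v) = (-1) ^ (sgn v.1 * v.2 b) *
    monomial X ((v.2 *~ v.2 b + delta_ffun ip *~ tri (v.2 b)) *~ sgn v.1).
  have split_sign (M P : C) (k1 k2 s : int) :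
      ((- M) ^ k1 * P ^ k2) ^ s = (-1) ^ (s * k1) * (M ^ k1 * P ^ k2) ^ s.
    by rewrite -(mulN1r M) (expfzMl _ _ k1) -mulrA (expfzMl _ _ s) exprz_exp (mulrC s).
  rewrite signed_powE split_sign (monomialMz X _ (sgn v.1)) (monomialD _ _ X0).
  by rewrite 2!monomialMz monomial_delta Xip.
under eq_bigr => v _ do rewrite mE.
rewrite big_split /= -monomial_sum //.
have -> : \sum_(v <- L) (v.2 *~ v.2 b + delta_ffun ip *~ tri (v.2 b)) *~ sgn v.1 = 0.
  apply/ffunP => c; rewrite ffunE sum_ffunE -[RHS](Lc c); apply: eq_bigr => v _.
  rewrite ffunMzE ffunE !ffunMzE ffunE !mulrzz.
  have mulE (a1 a2 a3 s : int) : (a1 * a2 + a3) * s = s * (a2 * a1 + a3) by ring.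
  exact: mulE.
rewrite monomial0 mulr1.
have -> : \prod_(v <- L) (-1) ^ (sgn v.1 * v.2 b) = (-1 : C) ^ (\sum_(v <- L) sgn v.1 * v.2 b).
  elim/big_rec2: _ => [|v y z _ ->]; first by rewrite expr0z.
  by rewrite expfzDr // oppr_eq0 oner_eq0.
rewrite Lb mulrC -exprz_exp.
have -> : (-1 : C) ^ (2 : int) = 1 by rewrite -exprnP sqrrN expr1n.
exact: exp1rz.
Qed.

End ThetaProduct.

(** * Certificates as lists of theta factors *)

Section CertificateList.
Variable N : nat.
Notation expo := {ffun option (option 'I_N) -> int}.
Implicit Types (L : seq (bool * expo)).

Definition x_ (i : 'I_N) : option (option 'I_N) := Some (Some i).
Definition q_ : option (option 'I_N) := Some None.

(* For d < 0 the product runs over i = d, ..., -1 and is inverted. *)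
Definition range_start (d : int) : int := if 0 <= d then 0 else d.

Definition steps (d : int) (k : nat) : seq int := [seq range_start d + i%:Z | i <- iota 0 k].

(** Rescaling x_a by q multiplies a monomial by q^d, where d is its x_a-exponent, so each Gamma
    leaves a chain of |d| thetas; the position in the chain is stored in the q-exponent. *)
Definition certificate (a : 'I_N) L : seq (bool * expo) :=
  flatten [seq [seq ((v : bool * expo).1 (+) (v.2 (x_ a) < 0), v.2 + delta_ffun q_ *~ i)
               | i <- steps (v.2 (x_ a)) `|v.2 (x_ a)|%N] | v <- L].

Lemma sum_steps (P F : int -> int) (d : int) :
  (forall i, F (i + 1) - F i = P i) ->
  sgn (d < 0) * \sum_(i <- steps d `|d|%N) P i = F d - F 0.
Proof.
move=> FP; have tel a k : \sum_(i <- [seq a + i%:Z | i <- iota 0 k]) P i = F (a + k%:Z) - F a.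
  elim: k => [|k IHk]; first by rewrite big_nil addr0 subrr.
  rewrite -[k.+1]addn1 iotaD map_cat big_cat /= IHk big_seq1 add0n -FP.
  have -> : a + k%:Z + 1 = a + (k + 1)%N by lia.
  ring.
rewrite /steps tel /range_start; case: d => n; rewrite /sgn /=.
  by rewrite mul1r add0r.
have -> : Negz n + n.+1%:Z = 0 by lia.
by rewrite mulN1r opprB.
Qed.

(** Each chain telescopes, for negative d with the opposite orientation. Sums over the thetas thus
    become sums over the Gamma list of one degree higher. *)
Lemma certificate_sum (a : 'I_N) L (P : expo -> int) (F : expo -> int -> int) :
  (forall (v : expo) i, F v (i + 1) - F v i = P (v + delta_ffun q_ *~ i)) ->
  \sum_(w <- certificate a L) sgn w.1 * P w.2 =
  \sum_(v <- L) sgn v.1 * (F v.2 (v.2 (x_ a)) - F v.2 0).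
Proof.
move=> FP; rewrite /certificate big_flatten big_map; apply: eq_bigr => v _.
rewrite big_map -(sum_steps (v.2 (x_ a)) (FP v.2)) mulrA mulr_sumr.
by apply: eq_bigr => i _ /=; congr (_ * _); case: v.1; case: (_ < 0).
Qed.

End CertificateList.

Section Certificate.
Variables (R : realType) (N : nat) (p : CC R).
Hypotheses (p_neq0 : p != 0) (p_lt1 : modulus p < 1).
Notation C := (CC R).
Notation T := ('rV[C]_N * C)%type.
Notation expo := {ffun option (option 'I_N) -> int}.
Implicit Types (L : seq (bool * expo)).

Definition gamma_prod L (q : C) (x : 'rV[C]_N) : C :=
  \prod_(v <- L) signed_pow (v : bool * expo).1 (ellGamma p q (monomial (coords p q x) v.2)).

(** The successor is there because a chain of |d| shifts passes through |d| + 1 Gamma arguments. *)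
Definition regular_at (a : 'I_N) L (q : C) (x : 'rV[C]_N) : Prop :=
  forall v : bool * expo, v \in L -> forall i, i \in steps (v.2 (x_ a)) `|v.2 (x_ a)|%N.+1 ->
    gamma_regular p q (monomial (coords p q x) (v.2 + delta_ffun (q_ N) *~ i)).

Lemma ellGamma_steps (q w : C) (d : int) : q != 0 -> modulus q < 1 -> w != 0 ->
  (forall i, i \in steps d `|d|%N.+1 -> gamma_regular p q (q ^ i * w)) ->
  ellGamma p q (q ^ d * w) / ellGamma p q w =
    signed_pow (d < 0) (\prod_(i <- steps d `|d|%N) theta p (q ^ i * w)) /\
  (forall i, i \in steps d `|d|%N -> theta p (q ^ i * w) != 0).
Proof.
move=> q0 q1 w0; have qw0 i : q ^ i * w != 0 by rewrite mulf_neq0 // expfz_neq0.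
have qS i : q ^ (i + 1) * w = q * (q ^ i * w) by rewrite expfzDr // expr1z; ring.
have ind a k : (forall i, i \in [seq a + i%:Z | i <- iota 0 k.+1] -> gamma_regular p q (q ^ i
  * w)) ->
    ellGamma p q (q ^ (a + k%:Z) * w) =
      (\prod_(i <- [seq a + i%:Z | i <- iota 0 k]) theta p (q ^ i * w)) * ellGamma p q (q ^ a * w)
    /\ (forall i, i \in [seq a + i%:Z | i <- iota 0 k] -> theta p (q ^ i * w) != 0).
  elim: k => [|k IHk] rw; first by rewrite big_nil mul1r addr0.
  have [i ik|IH1 IH2] := IHk.
    by apply: rw; rewrite -[k.+2]addn1 iotaD map_cat mem_cat ik.
  have r1 : gamma_regular p q (q ^ (a + k%:Z) * w).
    by apply: rw; apply/mapP; exists k => //; rewrite mem_iota; lia.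
  have r2 : gamma_regular p q (q * (q ^ (a + k%:Z) * w)).
    rewrite -qS; apply: rw; apply/mapP; exists k.+1; first by rewrite mem_iota; lia.
    by lia.
  split.
    have -> : a + k.+1%:Z = (a + k%:Z) + 1 by lia.
    rewrite qS ellGamma_shift // IH1 -[k.+1]addn1 iotaD map_cat big_cat /= big_seq1 add0n.
    by rewrite mulrCA mulrA.
  move=> i; rewrite -[k.+1]addn1 iotaD map_cat mem_cat => /orP[/IH2 //|].
  by rewrite /= inE => /eqP ->; rewrite add0n; apply: (theta_neq0 (q := q)).
have w0E : q ^ 0 * w = w by rewrite expr0z mul1r.
have start0 : range_start d \in steps d `|d|%N.+1.
  by apply/mapP; exists 0%N; rewrite ?mem_iota // addr0.
move=> rw; have [e1 e2] := ind _ _ rw; split => //; rewrite -/(steps d `|d|%N) in e1.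
have := ellGamma_neq0 p_lt1 q1 (rw _ start0); move: e1.
(* For negative [d] the chain starts at [q ^ d * w] and ends at [w], so the quotient appears
   inverted. *)
rewrite /range_start; case: d {rw e2 start0} => n /=.
  by rewrite add0r w0E => -> g0; rewrite mulfK.
have -> : Negz n + n.+1%:Z = 0 by lia.
by rewrite w0E => -> g0; rewrite invfM mulrCA divff // mulr1.
Qed.

Lemma gamma_prod_certificate (a : 'I_N) L (q : C) (x : 'rV[C]_N) :
  domain (x, q) -> regular_at a L q x ->
  gamma_prod L q (scale_var a q x) / gamma_prod L q x =
    theta_prod p (coords p q x) (certificate a L) /\
  (forall v : bool * expo, v \in certificate a L -> theta p (monomial (coords p q x) v.2) != 0).
Proof.
move=> Dxq reg; have [x0 /discP[q0 q1]] := Dxq.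
have X0 c : coords p q x c != 0 := coords_neq0 p_neq0 Dxq c.
have shiftE (v : expo) i : monomial (coords p q x) (v + delta_ffun (q_ N) *~ i) =
    q ^ i * monomial (coords p q x) v.
  by rewrite monomialD // monomialMz monomial_delta mulrC.
have key (v : bool * expo) : v \in L -> _ := fun vL =>
  @ellGamma_steps q (monomial (coords p q x) v.2)
  (v.2 (x_ a)) q0 q1 (monomial_neq0 _ X0) (fun i ia =>
    eq_rect _ (gamma_regular p q) (reg v vL i ia) _ (shiftE v.2 i)).
split; last first.
  move=> w /flattenP[/= l /mapP[v vL ->] /mapP[i ia ->]] /=.
  by rewrite shiftE; have [_] := key v vL; apply.
rewrite /theta_prod /certificate big_flatten big_map /gamma_prod -prodf_div.
apply: eq_big_seq => v vL; rewrite big_map monomial_scale_var.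
rewrite -signed_powV -signed_powM (key v vL).1 signed_pow_addb signed_pow_prod.
by apply: eq_bigr => i _ /=; rewrite shiftE.
Qed.

Lemma theta_differentiable (w : C) : w != 0 -> differentiable (theta p) w.
Proof.
move=> w0; apply: (@differentiableM _ _ (qpoch p) (fun w => qpoch p (p / w))).
  exact: qpoch_differentiable.
apply: (@differentiable_comp _ _ _ _ (fun w : C => p / w) (qpoch p));
  last exact: qpoch_differentiable.
apply: (@differentiableM _ _ (cst p) (fun w : C => w^-1)); first exact: differentiable_cst.
by apply: differentiableV => //; have := is_diff_id w; case.
Qed.

Lemma theta_monomial_differentiable (v : expo) (u : T) : domain u ->
  differentiable (fun u : T => theta p (monomial (coords p u.2 u.1) v)) u.
Proof.
move=> Du.
apply: (@differentiable_comp _ _ _ _ (fun u : T => monomial (coords p u.2 u.1) v) (theta p)).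
  exact: monomial_differentiable.
by apply: theta_differentiable; apply: monomial_neq0 => c; exact: coords_neq0.
Qed.

(** Moving along a chain changes only the q-exponent, so an x_i occurring in the original argument
    still occurs in each of the finitely many shifted ones. *)
Lemma fgeneric_regular (a : 'I_N) L :
  (forall v : bool * expo, v \in L -> exists i, v.2 (x_ i) != 0) -> fgeneric (regular_at a L).
Proof.
move=> Lx; apply: fgeneric_seq => v vL; apply: fgeneric_seq => k _.
have [i vi] := Lx v vL; apply: (fgeneric_gamma_regular p_neq0 p_lt1 (i := i)).
by rewrite !(ffunE, ffunMzE) /= mul0rz addr0.
Qed.

End Certificate.

Section MeroEq.
Variables (R : realType) (V : normedModType (CC R)) (U : set V).

Lemma mero_eq_sym (f g : V -> CC R) : mero_eq U f g -> mero_eq U g f.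
Proof. by move=> [W [oW WU UW fg]]; exists W; split => // x /fg. Qed.

Lemma mero_eq_trans (f g h : V -> CC R) :
  mero_eq U f g -> mero_eq U g h -> mero_eq U f h.
Proof.
move=> [W1 [oW1 W1U UW1 fg]] [W2 [oW2 W2U UW2 gh]]; exists (W1 `&` W2); split.
- exact: openI.
- by move=> x [/W1U].
- move=> x Ux A /nbhs_interior Ax; have [y [W1y Ay]] := UW1 x Ux _ Ax.
  have : nbhs y (A^° `&` W1).
    by apply: open_nbhs_nbhs; split => //; apply: openI => //; exact: open_interior.
  move=> /(UW2 y (W1U y W1y)) [z [W2z [Az W1z]]].
  by exists z; split => //; exact: interior_subset.
- by move=> x [/fg -> /gh].
Qed.

End MeroEq.

(** * Reduction of total ellipticity to identities between exponents *)

Section Ellipticity.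
Variables (R : realType) (N : nat) (p : CC R).
Hypotheses (p_neq0 : p != 0) (p_lt1 : modulus p < 1).
Notation C := (CC R).
Notation T := ('rV[C]_N * C)%type.
Notation expo := {ffun option (option 'I_N) -> int}.

Lemma scale_var_ctorus (b : 'I_N) (c : C) (x : 'rV[C]_N) :
  c != 0 -> ctorus x -> ctorus (scale_var b c x).
Proof. by move=> c0 x0 i; rewrite mxE; case: ifP => _ //; rewrite mulf_neq0. Qed.

Lemma scale_var_differentiable (b : 'I_N) (c : C) (x : 'rV[C]_N) :
  differentiable (@scale_var R N b c) x.
Proof.
rewrite (_ : scale_var b c = (id : 'rV[C]_N -> 'rV[C]_N) +
  (fun x : 'rV[C]_N => ((c - 1) * x 0 b) *: (delta_mx 0 b : 'rV[C]_N))); last first.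
  apply/funext => y; apply/rowP => j; rewrite !mxE /= eq_sym.
  by case: eqP => [->|_]; rewrite ?mulr0 ?addr0 // mulr1; ring.
apply: differentiableD; first by have := is_diff_id x; case.
apply: (@differentiableZl _ _ _ (fun x : 'rV[C]_N => (c - 1) * x 0 b)).
apply: (@differentiableM _ _ (cst (c - 1)) (fun x : 'rV[C]_N => x 0 b)).
  exact: differentiable_cst.
exact: differentiable_coord.
Qed.

Lemma scale_var_continuous (b : 'I_N) (c : C) : continuous (@scale_var R N b c).
Proof. by move=> x; apply: differentiable_continuous; exact: scale_var_differentiable. Qed.

Lemma scale_varK (b : 'I_N) (c : C) : c != 0 ->
  cancel (@scale_var R N b c) (scale_var b c^-1).
Proof.
by move=> c0 x; apply/rowP => j; rewrite !mxE; case: (j == b); rewrite ?mulKf.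
Qed.

(** The certificate agrees with its theta product only generically; this allows the comparison at
    the shifted point too. *)
Lemma fgeneric_scale_var (P : C -> 'rV[C]_N -> Prop) (b : 'I_N) (c : C) : c != 0 ->
  fgeneric P -> fgeneric (fun q x => P q (scale_var b c x)).
Proof.
move=> c0 [W [oW WD Wcl WP]].
have ci0 : c^-1 != 0 by rewrite invr_eq0.
exists [set u : T | domain u /\ W (scale_var b c u.1, u.2)]; split.
- have cS : continuous (fun u : T => (scale_var b c u.1, u.2)).
    move=> u; apply: differentiable_continuous.
    apply: (@differentiable_pair _ _ _ _ (fun u : T => scale_var b c u.1) (fun u : T => u.2)).
      apply: (@differentiable_comp _ _ _ _ (fun u : T => u.1) (@scale_var R N b c)).
        exact: fst_differentiable.
      exact: scale_var_differentiable.
    exact: snd_differentiable.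
  rewrite openE => u [Du Wu].
  have n1 : nbhs u (fun u => domain u) by apply: open_nbhs_nbhs; split => //; exact: domain_open.
  have n2 : nbhs u (fun u => W (scale_var b c u.1, u.2)) by apply: (cS u); exact: open_nbhs_nbhs.
  exact: filterI n1 n2.
- by move=> u [].
- move=> q q01 x x0 A Ax.
  have Sx0 := scale_var_ctorus b c0 x0.
  have nA : nbhs (scale_var b c x) (fun z => A (scale_var b c^-1 z)).
    by apply: scale_var_continuous; rewrite scale_varK.
  have [z [Wz Az]] := Wcl q q01 _ Sx0 _ nA.
  exists (scale_var b c^-1 z); split => //=.
  have zK : scale_var b c (scale_var b c^-1 z) = z.
    by rewrite -{1}[c]invrK scale_varK.
  rewrite zK; split => //; split => //=.
  by apply: scale_var_ctorus => //; case: (WD _ Wz).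
- by move=> x q [_] /WP.
Qed.

Lemma fgeneric_slice_closure (P : C -> 'rV[C]_N -> Prop) q : disc q -> fgeneric P ->
  @ctorus R N `<=` closure [set x | ctorus x /\ P q x].
Proof.
move=> q01 [W [oW WD Wcl WP]] x x0; have := Wcl q q01 x x0; apply: closure_subset => y /= Wy.
by split; [case: (WD _ Wy) | exact: WP].
Qed.

Lemma ctorus_open : open (@ctorus R N).
Proof.
have [q q01] : exists q : C, disc q.
  by exists p; apply/discP.
rewrite (_ : @ctorus R N = [set x | domain (x, q)]); first exact: slice_open (@domain_open R N).
by apply/seteqP; split => x; [move=> x0; split | case].
Qed.

Lemma totally_elliptic_gamma_prod (L : seq (bool * expo)) (Delta : C -> 'rV[C]_N -> C) :
  (forall q x, domain (x, q) -> Delta q x = gamma_prod p L q x) ->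
  (forall v : bool * expo, v \in L -> exists i, v.2 (x_ i) != 0) ->
  (forall (a : 'I_N) b c, \sum_(w <- certificate a L) sgn w.1 *
     (w.2 (Some b) * w.2 c + (c == None)%:Z * tri (w.2 (Some b))) = 0) ->
  (forall (a : 'I_N) b, exists k : int,
     \sum_(w <- certificate a L) sgn w.1 * w.2 (Some b) = k * 2) ->
  totally_elliptic p Delta.
Proof.
move=> DeltaE Lx Lcube Leven a h; pose K := certificate a L.
pose H q x := theta_prod p (coords p q x) K.
have hH : fgeneric (fun q x => h q x = H q x /\
    forall v : bool * expo, v \in K -> theta p (monomial (coords p q x) v.2) != 0).
  apply: fgenericW (fgeneric_regular p_neq0 p_lt1 a Lx) _ => x q Dxq reg.
  have [e1 e2] := gamma_prod_certificate p_neq0 p_lt1 Dxq reg.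
  split => //; rewrite /h /q_certificate !DeltaE //; case: Dxq => x0 q01.
  by split => //; apply: scale_var_ctorus => //; case/discP: q01.
(* [num] and [den] are holomorphic on the whole domain, so one fraction witnesses meromorphy at all
   points, jointly and on slices. *)
pose num (u : T) := \prod_(v <- K | ~~ v.1) theta p (monomial (coords p u.2 u.1) v.2).
pose den (u : T) := \prod_(v <- K | v.1) theta p (monomial (coords p u.2 u.1) v.2).
have HE q x : H q x = num (x, q) / den (x, q).
  rewrite /H /theta_prod (bigID (fun v : bool * expo => v.1)) /= mulrC; congr (_ * _).
    by apply: eq_bigr => v /negPf ->.
  by rewrite /den -prodfV; apply: eq_bigr => v ->.
have dnum u : domain u -> differentiable num u.
  by move=> Du; apply: differentiable_prod => v _; exact: theta_monomial_differentiable.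
have dden u : domain u -> differentiable den u.
  by move=> Du; apply: differentiable_prod => v _; exact: theta_monomial_differentiable.
have denN0 q x : (forall v : bool * expo, v \in K -> theta p (monomial (coords p q x) v.2) !=
  0) ->
    den (x, q) != 0.
  move=> tN0; rewrite /den prodf_seq_neq0; apply/allP => v vK; apply/implyP => _.
  exact: tN0.
have [W [oW WD DW WP]] := fgeneric_closure hH.
split.
  move=> u Du; exists (@domain R N), num, den; split => //.
  - by split => //; exact: domain_open.
  - move=> y Dy; have := DW y Dy; apply: closure_subset => z Wz; split; first exact: WD.
    by case: z Wz => z1 z2 /WP[_ /denN0].
  - exists W; split => // -[y1 y2] Wy; have [-> _] := WP _ Wy.
    exact: HE.
move=> q q01.
have Hmero r : disc r -> mero_eq (@ctorus R N) (h r) (H r).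
  by move=> r01; apply: (fgeneric_mero_slice r01 hH) => x _ [].
have X0 (x : 'rV[C]_N) : ctorus x -> forall c, coords p q x c != 0.
  by move=> x0 c; exact: (@coords_neq0 R N p (x, q) p_neq0 (conj x0 q01) c).
have Hscale b (x : 'rV[C]_N) : ctorus x ->
    theta_prod p (scale_coord (Some b) p (coords p q x)) K = H q x.
  by move=> x0; exact: (@theta_prod_scale _ _ p_neq0 p_lt1 _ None _ _ _ erefl (X0 x x0)
    (Lcube a b) (Leven a b)).
have [q0 q1] := (discP q).1 q01.
split.
- move=> x x0; exists (@ctorus R N), (fun x => num (x, q)), (fun x => den (x, q)); split.
  + by split => //; exact: ctorus_open.
  + move=> y y0; apply: (@differentiable_comp _ _ _ _ (fun x : 'rV[C]_N => (x, q) : T) num).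
      exact: slice_differentiable.
    exact: dnum.
  + move=> y y0; apply: (@differentiable_comp _ _ _ _ (fun x : 'rV[C]_N => (x, q) : T) den).
      exact: slice_differentiable.
    exact: dden.
  + move=> y y0; have := fgeneric_slice_closure q01 hH y0.
    by apply: closure_subset => z [z0 [_ /denN0]].
  + by have := Hmero q q01; congr mero_eq; apply/funext => y; exact: HE.
- move=> b; apply: mero_eq_trans (mero_eq_sym (Hmero q q01)).
  apply: (fgeneric_mero_slice q01 (fgeneric_scale_var b p_neq0 hH)) => x x0 [-> _].
  by rewrite /H coords_scale_var; exact: Hscale.
- have pq01 : disc (p * q).
    apply/discP; split; first exact: mulf_neq0.
    by rewrite modulusM mulr_ilt1 // modulus_ge0.
  apply: mero_eq_trans (mero_eq_sym (Hmero q q01)).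
  apply: (fgeneric_mero_slice pq01 hH) => x x0 [-> _].
  rewrite -(Hscale None x x0) /H; congr (theta_prod p _ K).
  by apply/funext => -[[i|]|].
Qed.

End Ellipticity.

(** * Moments of the exponents *)

Section DoubleSums.
Variable I : Type.
Implicit Type r : seq I.

Lemma sum_prod3 r (w1 w2 w3 b : int) (v1 v2 v3 : I -> int) :
  \sum_(j <- r) (w1 + b * v1 j) * (w2 + b * v2 j) * (w3 + b * v3 j) =
  (\sum_(j <- r) 1) * w1 * w2 * w3
  + b * (w1 * w2 * (\sum_(j <- r) v3 j) + w1 * w3 * (\sum_(j <- r) v2 j)
         + w2 * w3 * (\sum_(j <- r) v1 j))
  + b ^+ 2 * (w1 * (\sum_(j <- r) v2 j * v3 j) + w2 * (\sum_(j <- r) v1 j * v3 j)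
              + w3 * (\sum_(j <- r) v1 j * v2 j))
  + b ^+ 3 * (\sum_(j <- r) v1 j * v2 j * v3 j).
Proof. elim: r => [|j r IHr]; rewrite ?big_nil ?big_cons ?IHr; ring. Qed.

Lemma sum_prod2 r (w1 w2 b : int) (v1 v2 : I -> int) :
  \sum_(j <- r) (w1 + b * v1 j) * (w2 + b * v2 j) =
  (\sum_(j <- r) 1) * w1 * w2
  + b * (w1 * (\sum_(j <- r) v2 j) + w2 * (\sum_(j <- r) v1 j))
  + b ^+ 2 * (\sum_(j <- r) v1 j * v2 j).
Proof. elim: r => [|j r IHr]; rewrite ?big_nil ?big_cons ?IHr; ring. Qed.

Lemma sum_prod1 r (w1 b : int) (v1 : I -> int) :
  \sum_(j <- r) (w1 + b * v1 j) = (\sum_(j <- r) 1) * w1 + b * (\sum_(j <- r) v1 j).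
Proof. elim: r => [|j r IHr]; rewrite ?big_nil ?big_cons ?IHr; ring. Qed.

End DoubleSums.

Section DoubleSums2.
Variables (I J : Type) (r : seq I) (r' : seq J).
Variables (e1 e2 e3 a b : int) (u1 u2 u3 : I -> int) (v1 v2 v3 : J -> int).
Notation "'U1'" := (\sum_(i <- r) u1 i).
Notation "'U2'" := (\sum_(i <- r) u2 i).
Notation "'U3'" := (\sum_(i <- r) u3 i).
Notation "'U12'" := (\sum_(i <- r) u1 i * u2 i).
Notation "'U13'" := (\sum_(i <- r) u1 i * u3 i).
Notation "'U23'" := (\sum_(i <- r) u2 i * u3 i).
Notation "'U123'" := (\sum_(i <- r) u1 i * u2 i * u3 i).
Notation "'V1'" := (\sum_(i <- r') v1 i).
Notation "'V2'" := (\sum_(i <- r') v2 i).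
Notation "'V3'" := (\sum_(i <- r') v3 i).
Notation "'V12'" := (\sum_(i <- r') v1 i * v2 i).
Notation "'V13'" := (\sum_(i <- r') v1 i * v3 i).
Notation "'V23'" := (\sum_(i <- r') v2 i * v3 i).
Notation "'V123'" := (\sum_(i <- r') v1 i * v2 i * v3 i).
Notation "'M'" := (\sum_(i <- r) (1 : int)).
Notation "'K'" := (\sum_(i <- r') (1 : int)).

Lemma double_sum1 :
  \sum_(i <- r) \sum_(j <- r') (e1 + a * u1 i + b * v1 j) =
  M * K * e1 + a * K * U1 + b * M * V1.
Proof.
under eq_bigr do rewrite sum_prod1.
elim: r => [|i s IHs]; rewrite ?big_nil ?big_cons ?IHs; ring.
Qed.

Lemma double_sum2 :
  \sum_(i <- r) \sum_(j <- r') (e1 + a * u1 i + b * v1 j) * (e2 + a * u2 i + b * v2 j) =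
  M * K * e1 * e2 + a * K * (e1 * U2 + e2 * U1) + b * M * (e1 * V2 + e2 * V1)
  + a ^+ 2 * K * U12 + a * b * (U1 * V2 + U2 * V1) + b ^+ 2 * M * V12.
Proof.
under eq_bigr do rewrite sum_prod2.
elim: r => [|i s IHs]; rewrite ?big_nil ?big_cons ?IHs; ring.
Qed.

(** Each exponent of rho, centred or not, is affine in a member of each of two families, possibly
    equal. Double sums thus reduce to moments of single families, where the constraints apply. *)
Lemma double_sum3 :
  \sum_(i <- r) \sum_(j <- r') (e1 + a * u1 i + b * v1 j) * (e2 + a * u2 i + b * v2 j)
     * (e3 + a * u3 i + b * v3 j) =
  M * K * e1 * e2 * e3
  + a * K * (e1 * e2 * U3 + e1 * e3 * U2 + e2 * e3 * U1)
  + b * M * (e1 * e2 * V3 + e1 * e3 * V2 + e2 * e3 * V1)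
  + a ^+ 2 * K * (e1 * U23 + e2 * U13 + e3 * U12)
  + b ^+ 2 * M * (e1 * V23 + e2 * V13 + e3 * V12)
  + a * b * (e1 * (U2 * V3 + U3 * V2) + e2 * (U1 * V3 + U3 * V1) + e3 * (U1 * V2 + U2 * V1))
  + a ^+ 3 * K * U123 + b ^+ 3 * M * V123
  + a ^+ 2 * b * (U12 * V3 + U13 * V2 + U23 * V1)
  + a * b ^+ 2 * (U1 * V23 + U2 * V13 + U3 * V12).
Proof.
under eq_bigr do rewrite sum_prod3.
elim: r => [|i s IHs]; rewrite ?big_nil ?big_cons ?IHs; ring.
Qed.

End DoubleSums2.

Section TermList.
Variables (V : zmodType) (n m : nat).
Variables (z : 'I_n.+1 -> V) (y : 'I_m.+1 -> V) (s t : 'I_(n + m).+2 -> V) (c : V).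
Hypotheses (sum_z : \sum_j z j = 0) (sum_y : \sum_j y j = \sum_l s l).
Hypothesis sum_t : \sum_l t l = c *+ m.+1 - \sum_l s l.

(* true marks an inverted factor; c stands for the exponent vector of pq. *)
Definition off_diagonal k (b : bool) (w : 'I_k -> V) : seq (bool * V) :=
  [seq (b, w i - w j) | i <- index_enum 'I_k, j <- [seq j <- index_enum 'I_k | j != i]].

Definition term_list : seq (bool * V) :=
  [seq (false, s l + z j) | l <- index_enum 'I_(n + m).+2, j <- index_enum 'I_n.+1]
  ++ [seq (false, t l - z j) | l <- index_enum 'I_(n + m).+2, j <- index_enum 'I_n.+1]
  ++ off_diagonal true z
  ++ [seq (true, y j - s l) | l <- index_enum 'I_(n + m).+2, j <- index_enum 'I_m.+1]
  ++ [seq (true, c - t l - y j) | l <- index_enum 'I_(n + m).+2, j <- index_enum 'I_m.+1]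
  ++ off_diagonal false y
  ++ [seq (true, s k + t l) | k <- index_enum 'I_(n + m).+2, l <- index_enum 'I_(n + m).+2].

(** Completing the diagonal gives a full double sum; its [k] entries all equal [f 0]. *)
Lemma off_diagonal_sum k b (w : 'I_k -> V) (f : V -> int) :
  \sum_(v <- off_diagonal b w) sgn v.1 * f v.2 =
  sgn b * (\sum_i \sum_j f (w i - w j) - f 0 * k%:Z).
Proof.
rewrite /off_diagonal big_allpairs_dep /=.
under eq_bigr => i _.
  have -> : \sum_(j <- [seq j <- index_enum 'I_k | j != i]) sgn b * f (w i - w j) =
      sgn b * (\sum_j f (w i - w j) - f 0).
    rewrite big_filter -mulr_sumr [in RHS](bigD1 i) //= subrr addrAC subrr add0r //.
  over.
rewrite -mulr_sumr; congr (_ * _).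
by rewrite sumrB sumr_const card_ord -mulr_natr natz.
Qed.

Lemma term_list_sum (f : V -> int) :
  \sum_(v <- term_list) sgn v.1 * f v.2 =
  \sum_l \sum_j f (s l + z j) + \sum_l \sum_j f (t l - z j)
  - (\sum_i \sum_j f (z i - z j) - f 0 * n.+1%:Z)
  - \sum_l \sum_j f (y j - s l) - \sum_l \sum_j f (c - t l - y j)
  + (\sum_i \sum_j f (y i - y j) - f 0 * m.+1%:Z)
  - \sum_k \sum_l f (s k + t l).
Proof.
have pull (b : bool) (I J : finType) (F : I -> J -> int) :
    \sum_i \sum_j sgn b * F i j = sgn b * (\sum_i \sum_j F i j).
  by rewrite mulr_sumr; apply: eq_bigr => i _; rewrite mulr_sumr.
rewrite /term_list !big_cat /= !off_diagonal_sum !big_allpairs_dep /=.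
rewrite !(pull true) !(pull false) /sgn !mul1r !mulN1r !addrA.
by [].
Qed.


Lemma sum_zE (f : {additive V -> int}) : \sum_j f (z j) = 0.
Proof. by rewrite -raddf_sum sum_z raddf0. Qed.

Lemma sum_yE (f : {additive V -> int}) : \sum_j f (y j) = \sum_l f (s l).
Proof. by rewrite -!raddf_sum sum_y. Qed.

Lemma sum_tE (f : {additive V -> int}) :
  \sum_l f (t l) = f c * m.+1%:Z - \sum_l f (s l).
Proof. by rewrite -!raddf_sum sum_t raddfB raddfMn -mulr_natr natz. Qed.

Lemma sum_ord1 k : \sum_(i < k) (1 : int) = k%:Z.
Proof. by rewrite sumr_const card_ord -mulr_natr mul1r natz. Qed.

Section Moments.
Variables (f1 f2 f3 : {additive V -> int}).

(* Centring at the symmetry point of Gamma(w) Gamma(pq/w) = 1 makes the cubic form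
   vanish; if f1 c, f2 c, f3 c are all nonzero, a multiple of (m - n) remains. *)
Lemma term_list_cubic : f1 c = 0 ->
  \sum_(v <- term_list) sgn v.1 *
    ((2 * f1 v.2 - f1 c) * (2 * f2 v.2 - f2 c) * (2 * f3 v.2 - f3 c)) = 0.
Proof.
move=> f1c.
rewrite (term_list_sum (fun v => (2 * f1 v - f1 c) * (2 * f2 v - f2 c) * (2 * f3 v - f3 c))).
have fam (I J : finType) (a b d : int) (u : I -> V) (w : J -> V) (g : I -> J -> V) :
    (forall (f : {additive V -> int}) i j,
       2 * f (g i j) - f c = d * f c + a * f (u i) + b * f (w j)) ->
    \sum_i \sum_j (2 * f1 (g i j) - f1 c) * (2 * f2 (g i j) - f2 c) * (2 * f3 (g i j) - f3 c) =
    \sum_i \sum_j (d * f1 c + a * f1 (u i) + b * f1 (w j))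
      * (d * f2 c + a * f2 (u i) + b * f2 (w j)) * (d * f3 c + a * f3 (u i) + b * f3 (w j)).
  by move=> H; apply: eq_bigr => i _; apply: eq_bigr => j _; rewrite !H.
rewrite (fam _ _ 2 2 (-1) s z); last by move=> f i j; rewrite raddfD; ring.
rewrite (fam _ _ 2 (-2) (-1) t z); last by move=> f i j; rewrite raddfB; ring.
rewrite (fam _ _ 2 (-2) (-1) z z); last by move=> f i j; rewrite raddfB; ring.
rewrite (fam _ _ (-2) 2 (-1) s y); last by move=> f i j; rewrite raddfB; ring.
rewrite (fam _ _ (-2) (-2) 1 t y); last by move=> f i j; rewrite !raddfB; ring.
rewrite (fam _ _ 2 (-2) (-1) y y); last by move=> f i j; rewrite raddfB; ring.
rewrite (fam _ _ 2 2 (-1) s t); last by move=> f i j; rewrite raddfD; ring.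
rewrite !double_sum3 !raddf0.
rewrite !sum_zE !sum_yE !sum_tE !sum_ord1 f1c.
have -> : (n + m).+2%:Z = n%:Z + m%:Z + 2 by lia.
have -> : n.+1%:Z = n%:Z + 1 by lia.
have -> : m.+1%:Z = m%:Z + 1 by lia.
ring.
Qed.

Lemma term_list_linear : f1 c = 0 -> \sum_(v <- term_list) sgn v.1 * f1 v.2 = 0.
Proof.
move=> f1c; rewrite (term_list_sum f1).
have fam (I J : finType) (a b d : int) (u : I -> V) (w : J -> V) (g : I -> J -> V) :
    (forall (f : {additive V -> int}) i j,
       f (g i j) = d * f c + a * f (u i) + b * f (w j)) ->
    \sum_i \sum_j f1 (g i j) = \sum_i \sum_j (d * f1 c + a * f1 (u i) + b * f1 (w j)).
  by move=> H; apply: eq_bigr => i _; apply: eq_bigr => j _; rewrite !H.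
rewrite (fam _ _ 1 1 0 s z); last by move=> f i j; rewrite raddfD; ring.
rewrite (fam _ _ 1 (-1) 0 t z); last by move=> f i j; rewrite raddfB; ring.
rewrite (fam _ _ 1 (-1) 0 z z); last by move=> f i j; rewrite raddfB; ring.
rewrite (fam _ _ (-1) 1 0 s y); last by move=> f i j; rewrite raddfB; ring.
rewrite (fam _ _ (-1) (-1) 1 t y); last by move=> f i j; rewrite !raddfB; ring.
rewrite (fam _ _ 1 (-1) 0 y y); last by move=> f i j; rewrite raddfB; ring.
rewrite (fam _ _ 1 1 0 s t); last by move=> f i j; rewrite raddfD; ring.
rewrite !double_sum1 !raddf0 !sum_zE !sum_yE !sum_tE !sum_ord1 f1c.
have -> : (n + m).+2%:Z = n%:Z + m%:Z + 2 by lia.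
have -> : n.+1%:Z = n%:Z + 1 by lia.
have -> : m.+1%:Z = m%:Z + 1 by lia.
ring.
Qed.

(** Arranged for parity: apart from the last summand everything is visibly even, and that summand
    survives only if [f2 c] is nonzero, as for the q-coordinate. *)
Lemma term_list_bilinear : f1 c = 0 ->
  \sum_(v <- term_list) sgn v.1 * (f1 v.2 * f2 v.2) =
  2 * (- (m.+1%:Z * (\sum_l f1 (s l) * f2 (s l) + \sum_l f1 (t l) * f2 (t l)))
       + m.+1%:Z * (\sum_j f1 (z j) * f2 (z j)) - n.+1%:Z * (\sum_j f1 (y j) * f2 (y j))
       + 2 * (\sum_l f1 (s l)) * (\sum_l f2 (s l)) - m.+1%:Z * f2 c * (\sum_l f1 (s l)))
  + n.+1%:Z * f2 c * (\sum_l f1 (s l)).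
Proof.
move=> f1c; rewrite (term_list_sum (fun v => f1 v * f2 v)).
have fam (I J : finType) (a b d : int) (u : I -> V) (w : J -> V) (g : I -> J -> V) :
    (forall (f : {additive V -> int}) i j,
       f (g i j) = d * f c + a * f (u i) + b * f (w j)) ->
    \sum_i \sum_j f1 (g i j) * f2 (g i j) =
    \sum_i \sum_j (d * f1 c + a * f1 (u i) + b * f1 (w j))
      * (d * f2 c + a * f2 (u i) + b * f2 (w j)).
  by move=> H; apply: eq_bigr => i _; apply: eq_bigr => j _; rewrite !H.
rewrite (fam _ _ 1 1 0 s z); last by move=> f i j; rewrite raddfD; ring.
rewrite (fam _ _ 1 (-1) 0 t z); last by move=> f i j; rewrite raddfB; ring.
rewrite (fam _ _ 1 (-1) 0 z z); last by move=> f i j; rewrite raddfB; ring.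
rewrite (fam _ _ (-1) 1 0 s y); last by move=> f i j; rewrite raddfB; ring.
rewrite (fam _ _ (-1) (-1) 1 t y); last by move=> f i j; rewrite !raddfB; ring.
rewrite (fam _ _ 1 (-1) 0 y y); last by move=> f i j; rewrite raddfB; ring.
rewrite (fam _ _ 1 1 0 s t); last by move=> f i j; rewrite raddfD; ring.
rewrite !double_sum2 !raddf0 !sum_zE !sum_yE !sum_tE !sum_ord1 f1c.
have -> : (n + m).+2%:Z = n%:Z + m%:Z + 2 by lia.
have -> : n.+1%:Z = n%:Z + 1 by lia.
have -> : m.+1%:Z = m%:Z + 1 by lia.
ring.
Qed.

End Moments.

End TermList.

Section Coordinate.
Variable I : finType.

(** Evaluation is named so that it can carry an additive structure and serve as a linear form in the
    moment lemmas. *)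
Definition coordinate (i : I) (v : {ffun I -> int}) : int := v i.

Lemma coordinate_is_additive i : zmod_morphism (coordinate i).
Proof. by move=> v w; rewrite /coordinate !ffunE. Qed.

HB.instance Definition _ i :=
  GRing.isZmodMorphism.Build {ffun I -> int} int (coordinate i) (coordinate_is_additive i).

End Coordinate.

(** * From moments of the Gamma list to conditions on the certificates *)

Section CertificateMoments.
Variables (N n m : nat).
Notation expo := {ffun option (option 'I_N) -> int}.
Variables (z : 'I_n.+1 -> expo) (y : 'I_m.+1 -> expo) (s t : 'I_(n + m).+2 -> expo).
Let c : expo := delta_ffun None + delta_ffun (Some None).
Hypotheses (sum_z : \sum_j z j = 0) (sum_y : \sum_j y j = \sum_l s l).
Hypothesis sum_t : \sum_l t l = c *+ m.+1 - \sum_l s l.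
Let L := term_list z y s t c.

Lemma weighted_sum_linear (r : seq (bool * expo)) (k1 k2 k3 k4 k5 k6 k7 : int)
    (g1 g2 g3 g4 g5 g6 g7 : expo -> int) :
  \sum_(v <- r) sgn v.1 * (k1 * g1 v.2 + k2 * g2 v.2 + k3 * g3 v.2 + k4 * g4 v.2
    + k5 * g5 v.2 + k6 * g6 v.2 + k7 * g7 v.2) =
  k1 * (\sum_(v <- r) sgn v.1 * g1 v.2) + k2 * (\sum_(v <- r) sgn v.1 * g2 v.2)
  + k3 * (\sum_(v <- r) sgn v.1 * g3 v.2) + k4 * (\sum_(v <- r) sgn v.1 * g4 v.2)
  + k5 * (\sum_(v <- r) sgn v.1 * g5 v.2) + k6 * (\sum_(v <- r) sgn v.1 * g6 v.2)
  + k7 * (\sum_(v <- r) sgn v.1 * g7 v.2).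
Proof. elim: r => [|v r IHr]; rewrite ?big_nil ?big_cons ?IHr; ring. Qed.

(** Summing along q-shifts turns the quadratic expression in theta exponents into a cubic one in
    Gamma exponents, divisible by the x_a-exponent; it is then a combination of centred cubic
    moments and the linear moment. *)
Lemma certificate_cubic (a : 'I_N) b i :
  \sum_(w <- certificate a L) sgn w.1 *
    (w.2 (Some b) * w.2 i + (i == None)%:Z * tri (w.2 (Some b))) = 0.
Proof.
pose fa := coordinate (x_ a); pose fb := coordinate (Some b); pose fi := coordinate i.
have fac : fa c = 0 by rewrite /fa /coordinate !ffunE.
pose be : int := (b == None)%:Z; pose ga : int := (i == Some None)%:Z.
pose de : int := (i == None)%:Z.
have fbc : fb c = be by rewrite /fb /coordinate /c !ffunE add0r.
have fic : fi c = ga + de by rewrite /fi /coordinate /c !ffunE /ga /de addrC.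
have gade : ga * de = 0 by rewrite /ga /de; case: (i) => [[?|]|]; rewrite ?mulr0 ?mul0r.
(* The factor 12 clears the 2 in [tri] together with the denominators 2 and 6 from summing i and
   i^2. *)
pose P (v : expo) := 12 * (fb v * fi v) + 6 * de * (fb v * (fb v - 1)).
have E : 12 * (\sum_(w <- certificate a L) sgn w.1 *
    (w.2 (Some b) * w.2 i + (i == None)%:Z * tri (w.2 (Some b)))) =
    \sum_(w <- certificate a L) sgn w.1 * P w.2.
  rewrite mulr_sumr; apply: eq_bigr => w _; rewrite /P -tri2 -/de /fb /fi /coordinate.
  by move: (tri _) => x; ring.
(* The discrete antiderivative of P along q-shifts. *)
pose F (v : expo) (k : int) := 12 * k * fb v * fi v + 6 * k * (k - 1) * (fb v * ga + fi v * be)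
  + 2 * be * ga * k * (k - 1) * (2 * k - 1)
  + de * (6 * k * fb v * (fb v - 1) + 3 * be * (2 * fb v - 1) * k * (k - 1)
          + be ^+ 2 * k * (k - 1) * (2 * k - 1)).
have FP v k : F v (k + 1) - F v k = P (v + delta_ffun (q_ N) *~ k).
  have vb : fb (v + delta_ffun (q_ N) *~ k) = fb v + be * k.
    by rewrite /fb /coordinate ffunE ffunMzE ffunE mulrzz.
  have vi : fi (v + delta_ffun (q_ N) *~ k) = fi v + ga * k.
    by rewrite /fi /coordinate ffunE ffunMzE ffunE mulrzz.
  rewrite /P vb vi /F; ring.
have F0 v : F v 0 = 0 by rewrite /F; ring.
suff : 48 * (\sum_(w <- certificate a L) sgn w.1 *
    (w.2 (Some b) * w.2 i + (i == None)%:Z * tri (w.2 (Some b)))) = 0.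
  by move/eqP; rewrite mulf_eq0 => /eqP.
(* The further 4 keeps the coefficients integral when the cubic is rewritten in the doubled centred
   values. *)
have -> : (48 : int) = 4 * 12 by [].
rewrite -mulrA E (certificate_sum a L FP) mulr_sumr.
pose A (v : expo) := 2 * fa v - fa c.
pose B (v : expo) := 2 * fb v - fb c.
pose D (v : expo) := 2 * fi v - fi c.
have cubic (f g h : {additive expo -> int}) := @term_list_cubic _ n m z y s t c sum_z sum_y
  sum_t f g h.
have lin := @term_list_linear _ n m z y s t c sum_z sum_y sum_t.
(* Recentring leaves a remainder proportional to [fa] alone, which the linear moment removes; the
   last term [0 * fa] is padding for [weighted_sum_linear]. *)
transitivity (\sum_(v <- L) sgn v.1 *
  (6 * (A v.2 * B v.2 * D v.2) + (3 * ga + 3 * be * de) * (A v.2 * A v.2 * B v.2)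
   + 3 * be * (A v.2 * A v.2 * D v.2) + (2 * be * ga + be ^+ 2 * de) * (A v.2 * A v.2 * A v.2)
   + (- 4 * be * ga - 2 * be ^+ 2 * de) * fa v.2 + 3 * de * (A v.2 * B v.2 * B v.2) + 0 * fa
     v.2)).
  apply: eq_bigr => v _; rewrite F0 subr0 mulrCA; congr (_ * _).
  rewrite /A /B /D fac fbc fic /F -/(coordinate (x_ a) v.2) -/fa.
  case: (i) @ga @de gade {fic FP F0 P E F A B D cubic lin} => [[?|]|] /= _; ring.
rewrite (weighted_sum_linear L _ _ _ _ _ _ _ (fun v => A v * B v * D v)
  (fun v => A v * A v * B v) (fun v => A v * A v * D v) (fun v => A v * A v * A v) fa
  (fun v => A v * B v * B v) fa).
rewrite (cubic fa fb fi fac) (cubic fa fa fb fac) (cubic fa fa fi fac) (cubic fa fa fa fac).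
by rewrite (cubic fa fb fb fac) (lin fa fac) !mulr0 !addr0.
Qed.

Lemma sum_square (k : nat) (f : 'I_k -> int) :
  \sum_i f i * f i = 2 * (\sum_i tri (f i)) + \sum_i f i.
Proof.
rewrite mulr_sumr -big_split; apply: eq_bigr => i _ /=.
by rewrite (mulrC 2) tri2; ring.
Qed.

Lemma certificate_even (a : 'I_N) b : exists k : int,
  \sum_(w <- certificate a L) sgn w.1 * w.2 (Some b) = k * 2.
Proof.
pose fa := coordinate (x_ a); pose fb := coordinate (Some b).
have fac : fa c = 0 by rewrite /fa /coordinate !ffunE.
pose be : int := (b == None)%:Z.
have fbc : fb c = be by rewrite /fb /coordinate /c !ffunE add0r.
pose F (v : expo) (k : int) := k * fb v + be * tri k.
have FP v k : F v (k + 1) - F v k = fb (v + delta_ffun (q_ N) *~ k).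
  have -> : fb (v + delta_ffun (q_ N) *~ k) = fb v + be * k.
    by rewrite /fb /coordinate ffunE ffunMzE ffunE mulrzz.
  rewrite /F triS; ring.
have F0 v : F v 0 = 0 by rewrite /F tri0; ring.
have bil (g : {additive expo -> int}) := @term_list_bilinear _ n m z y s t c sum_z sum_y
  sum_t fa g fac.
have bab : \sum_(v <- L) sgn v.1 * (fa v.2 * fb v.2) =
  2 * (- (m.+1%:Z * (\sum_l fa (s l) * fb (s l) + \sum_l fa (t l) * fb (t l)))
       + m.+1%:Z * (\sum_j fa (z j) * fb (z j)) - n.+1%:Z * (\sum_j fa (y j) * fb (y j))
       + 2 * (\sum_l fa (s l)) * (\sum_l fb (s l)) - m.+1%:Z * be * (\sum_l fa (s l)))
  + n.+1%:Z * be * (\sum_l fa (s l)) by rewrite -fbc; exact: bil.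
have baa0 x : fa c = x -> \sum_(v <- L) sgn v.1 * (fa v.2 * fa v.2) =
  2 * (- (m.+1%:Z * (\sum_l fa (s l) * fa (s l) + \sum_l fa (t l) * fa (t l)))
       + m.+1%:Z * (\sum_j fa (z j) * fa (z j)) - n.+1%:Z * (\sum_j fa (y j) * fa (y j))
       + 2 * (\sum_l fa (s l)) * (\sum_l fa (s l)) - m.+1%:Z * x * (\sum_l fa (s l)))
  + n.+1%:Z * x * (\sum_l fa (s l)) by move=> <-; exact: bil.
have baa := baa0 0 fac.
have lin := @term_list_linear _ n m z y s t c sum_z sum_y sum_t fa fac.
pose E := \sum_(w <- certificate a L) sgn w.1 * w.2 (Some b).
have -> : \sum_(w <- certificate a L) sgn w.1 * w.2 (Some b) = E by [].
have E2 : 2 * E = 2 * (\sum_(v <- L) sgn v.1 * (fa v.2 * fb v.2))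
    + be * (\sum_(v <- L) sgn v.1 * (fa v.2 * fa v.2)) - be * (\sum_(v <- L) sgn v.1 * fa v.2).
  rewrite /E (certificate_sum a L FP) !mulr_sumr -big_split -sumrB; apply: eq_bigr => v _ /=.
  rewrite F0 subr0 /F -/(coordinate (x_ a) v.2) -/fa.
  have expand (x1 x2 x3 x4 : int) : x1 * 2 = x2 * (x2 - 1) ->
      2 * (x4 * (x2 * x3 + be * x1)) =
      2 * (x4 * (x2 * x3)) + be * (x4 * (x2 * x2)) - be * (x4 * x2).
    move=> e; have -> : 2 * (x4 * (x2 * x3 + be * x1)) =
      2 * (x4 * (x2 * x3)) + be * x4 * (x1 * 2) by ring.
    by rewrite e; ring.
  exact: expand (tri2 _).
have sqz := sum_square (fun j => fa (z j)); have sqs := sum_square (fun l => fa (s l)).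
have sqy := sum_square (fun j => fa (y j)); have sqt := sum_square (fun l => fa (t l)).
have zE : \sum_j fa (z j) = 0 := sum_zE sum_z fa.
have yE : \sum_j fa (y j) = \sum_l fa (s l) := sum_yE sum_y fa.
have tE : \sum_l fa (t l) = fa c * m.+1%:Z - \sum_l fa (s l) := sum_tE sum_t fa.
have {}lin : \sum_(v <- L) sgn v.1 * fa v.2 = 0 := lin.
move: E2; rewrite bab baa lin sqz sqs sqy sqt zE yE tE fac.
set S12 := \sum_l fa (s l) * fb (s l); set T12 := \sum_l fa (t l) * fb (t l).
set Z12 := \sum_j fa (z j) * fb (z j); set Y12 := \sum_j fa (y j) * fb (y j).
set S1 := \sum_l fa (s l); set S2 := \sum_l fb (s l).
set St := \sum_l tri (fa (s l)); set Tt := \sum_l tri (fa (t l)).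
set Zt := \sum_j tri (fa (z j)); set Yt := \sum_j tri (fa (y j)).
set k1 : int := n.+1; set k2 : int := m.+1.
move: E S12 T12 Z12 Y12 S1 S2 St Tt Zt Yt k1 k2 => E S12 T12 Z12 Y12 S1 S2 St Tt Zt Yt k1 k2 E2.
(* The possibly odd term [k1 * be * S1] of the mixed bilinear moment cancels against the one that
   [sum_square] extracts from the y's, since these sum to [S1]; the rest is twice this witness. *)
exists (- (k2 * (S12 + T12)) + k2 * Z12 - k1 * Y12 + 2 * S1 * S2 - k2 * be * S1
  + be * (- (k2 * (St + Tt)) + k2 * Zt - k1 * Yt + S1 * S1)).
apply: (@mulfI _ (2 : int)) => //; rewrite E2; ring.
Qed.

End CertificateMoments.

(** * The exponents of rho *)

Section AppendLast.
Variables (T : Type) (k : nat) (v : 'I_k -> T) (c : T).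

(** [append_last] over an arbitrary type, so that exponent vectors can be appended too. *)
Definition snoc (i : 'I_k.+1) : T := if unlift ord_max i is Some j then v j else c.

Lemma snoc_max : snoc ord_max = c. Proof. by rewrite /snoc unlift_none. Qed.

Lemma snoc_lift j : snoc (lift ord_max j) = v j. Proof. by rewrite /snoc liftK. Qed.

End AppendLast.

Lemma sum_snoc (V : zmodType) k (v : 'I_k -> V) c :
  \sum_i snoc v c i = \sum_j v j + c.
Proof.
rewrite (bigD1_ord ord_max) //= snoc_max addrC; congr (_ + _).
by apply: eq_bigr => j _; rewrite snoc_lift.
Qed.

(** Matches the ordered pairs in the exponent list with the kernel, which runs over i < j with two
    Gammas per pair. *)
Lemma prod_off_diagonal (F : fieldType) k (f : 'I_k -> 'I_k -> F) :
  \prod_i \prod_(j | j != i) f i j =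
  \prod_(i < k) \prod_(j < k | (i < j)%N) (f i j * f j i).
Proof.
under [RHS]eq_bigr do rewrite big_split /=.
rewrite [RHS]big_split /= [X in _ = _ * X](exchange_big_dep predT) //= -big_split /=.
apply: eq_bigr => i _; rewrite (bigID (fun j : 'I_k => (i < j)%N)) /=; congr (_ * _).
  by apply: eq_bigl => j; rewrite -val_eqE /=; lia.
by apply: eq_bigl => j; rewrite -val_eqE /=; lia.
Qed.

Section RhoTerms.
Variables (R : realType) (n m : nat) (p : CC R).
Hypotheses (p_neq0 : p != 0) (p_lt1 : modulus p < 1).
Notation C := (CC R).
Notation N := (nvars n m).
Notation expo := {ffun option (option 'I_N) -> int}.

Definition zi (j : 'I_n) : 'I_N := lshift _ j.
Definition yi (j : 'I_m) : 'I_N := rshift n (lshift _ j).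
Definition si (l : 'I_(n + m).+2) : 'I_N := rshift n (rshift m (lshift _ l)).
Definition ti (l : 'I_(n + m).+1) : 'I_N := rshift n (rshift m (rshift _ l)).

Definition var (i : 'I_N) : expo := delta_ffun (x_ i).
Definition pq_expo : expo := delta_ffun None + delta_ffun (Some None).

Definition z_expo : 'I_n.+1 -> expo := snoc (var \o zi) (- \sum_j var (zi j)).
Definition s_expo (l : 'I_(n + m).+2) : expo := var (si l).
Definition y_expo : 'I_m.+1 -> expo :=
  snoc (var \o yi) (\sum_l s_expo l - \sum_j var (yi j)).
Definition t_expo : 'I_(n + m).+2 -> expo :=
  snoc (var \o ti) (pq_expo *+ m.+1 - (\sum_l s_expo l + \sum_l var (ti l))).

Definition rho_terms := term_list z_expo y_expo s_expo t_expo pq_expo.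

Lemma sum_z_expo : \sum_j z_expo j = 0.
Proof. by rewrite sum_snoc subrr. Qed.

Lemma sum_y_expo : \sum_j y_expo j = \sum_l s_expo l.
Proof. by rewrite sum_snoc addrC subrK. Qed.

Lemma sum_t_expo : \sum_l t_expo l = pq_expo *+ m.+1 - \sum_l s_expo l.
Proof.
have cancel_last (a b d : expo) : a + (b - (d + a)) = b - d.
  by rewrite (addrCA a b) opprD (addrCA a) subrr addr0.
by rewrite sum_snoc cancel_last.
Qed.

Lemma var_at i k : var i (x_ k) = (k == i)%:Z.
Proof. by rewrite ffunE; congr (nat_of_bool _)%:Z; apply/eqP/eqP => [[]|->]. Qed.

Lemma sum_var_at0 J (h : 'I_J -> 'I_N) k : (forall j, k != h j) ->
  (\sum_j var (h j)) (x_ k) = 0.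
Proof. by move=> kh; rewrite sum_ffunE big1 // => j _; rewrite var_at (negPf (kh j)). Qed.

Lemma sum_var_at1 J (h : 'I_J -> 'I_N) k : injective h -> (\sum_j var (h j)) (x_ (h k)) = 1.
Proof.
move=> hI; rewrite sum_ffunE (bigD1 k) //= var_at eqxx big1 ?addr0 // => j /negPf jk.
by rewrite var_at inj_eq // eq_sym jk.
Qed.

Lemma expoD_at (v w : expo) a : (v + w) a = v a + w a.
Proof. by rewrite ffunE. Qed.

Lemma expoN_at (v : expo) a : (- v) a = - v a.
Proof. by rewrite ffunE. Qed.

Lemma expoB_at (v w : expo) a : (v - w) a = v a - w a.
Proof. by rewrite expoD_at expoN_at. Qed.

Lemma pq_expo_at k : pq_expo (x_ k) = 0.
Proof. by rewrite !ffunE. Qed.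

Lemma pq_expoMn_at k r : (pq_expo *+ r) (x_ k) = 0.
Proof. by rewrite ffunMnE pq_expo_at mul0rn. Qed.

Lemma zi_inj : injective zi. Proof. exact: lshift_inj. Qed.
Lemma yi_inj : injective yi. Proof. by move=> i j /rshift_inj/lshift_inj. Qed.
Lemma si_inj : injective si. Proof. by move=> i j /rshift_inj/rshift_inj/lshift_inj. Qed.
Lemma ti_inj : injective ti. Proof. by move=> i j /rshift_inj/rshift_inj/rshift_inj. Qed.

Lemma zi_neq_si i j : zi i != si j. Proof. by rewrite eq_lrshift. Qed.
Lemma zi_neq_ti i j : zi i != ti j. Proof. by rewrite eq_lrshift. Qed.
Lemma yi_neq_si i j : yi i != si j. Proof. by rewrite eq_rshift eq_lrshift. Qed.
Lemma yi_neq_ti i j : yi i != ti j. Proof. by rewrite eq_rshift eq_lrshift. Qed.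
Lemma si_neq_ti i j : si i != ti j. Proof. by rewrite !eq_rshift eq_lrshift. Qed.

Lemma z_expo_at0 j k : (forall i, k != zi i) -> z_expo j (x_ k) = 0.
Proof.
move=> kz; rewrite /z_expo /snoc; case: unlift => [i|] /=.
  by rewrite var_at (negPf (kz i)).
by rewrite expoN_at sum_var_at0 // oppr0.
Qed.

Lemma y_expo_at_ti j k : y_expo j (x_ (ti k)) = 0.
Proof.
rewrite /y_expo /snoc; case: unlift => [i|] /=.
  by rewrite var_at eq_sym (negPf (yi_neq_ti _ _)).
rewrite expoB_at !sum_var_at0 ?subrr // => i; rewrite eq_sym ?yi_neq_ti //.
exact: si_neq_ti.
Qed.

(** The eliminated t has exponent -1 in every free t, and at least one of these exists because there
    are n + m + 1. *)
Lemma t_expo_at_ti l : exists k, t_expo l (x_ (ti k)) != 0.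
Proof.
rewrite /t_expo /snoc; case: unlift => [i|] /=.
  by exists i; rewrite var_at eqxx.
exists ord0; rewrite expoB_at pq_expoMn_at add0r expoD_at (sum_var_at1 _ ti_inj).
by rewrite sum_var_at0 // => i; rewrite eq_sym si_neq_ti.
Qed.

(** A free variable minus the eliminated one has coordinate 1 - (-1) = 2, so it cannot cancel. *)
Lemma snoc_diff_neq0 k (h : 'I_k -> 'I_N) (c : expo) (i j : 'I_k.+1) : injective h ->
  (forall l, c (x_ (h l)) = -1) -> i != j ->
  exists a, (snoc (var \o h) c i - snoc (var \o h) c j) (x_ a) != 0.
Proof.
move=> hI cE ij; case: (unliftP ord_max i) ij => [i' ->|->]; case: (unliftP ord_max j) =>
  [j' ->|->].
- rewrite (inj_eq lift_inj) => ij; exists (h i').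
  by rewrite !snoc_lift expoB_at /= !var_at eqxx inj_eq // (negPf ij).
- by move=> _; exists (h i'); rewrite snoc_lift snoc_max expoB_at /= var_at eqxx cE.
- by move=> _; exists (h j'); rewrite snoc_lift snoc_max expoB_at /= var_at eqxx cE.
- by rewrite eqxx.
Qed.

(** An argument depending only on p and q could be degenerate for all x at some fixed q; this
    excludes it. *)
Lemma rho_terms_nonconstant (v : bool * expo) : v \in rho_terms ->
  exists i, v.2 (x_ i) != 0.
Proof.
have zt j k : z_expo j (x_ (ti k)) = 0.
  by apply: z_expo_at0 => i; rewrite eq_sym zi_neq_ti.
have st l k : s_expo l (x_ (ti k)) = 0.
  by rewrite var_at eq_sym (negPf (si_neq_ti _ _)).
rewrite /rho_terms /term_list !mem_cat => /or4P[||| /or4P[|||]].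
- case/allpairsP => -[l j] [_ _ ->] /=; exists (si l).
  rewrite expoD_at var_at eqxx z_expo_at0 // => i; by rewrite eq_sym zi_neq_si.
- case/allpairsP => -[l j] [_ _ ->] /=; have [k tk] := t_expo_at_ti l; exists (ti k).
  by rewrite expoB_at zt subr0.
- case/allpairsPdep => i [j [_ + ->]] /=; rewrite mem_filter => /andP[ji _].
  apply: snoc_diff_neq0; [exact: zi_inj | | by rewrite eq_sym].
  by move=> l; rewrite expoN_at (sum_var_at1 _ zi_inj).
- case/allpairsP => -[l j] [_ _ ->] /=; rewrite /y_expo.
  case: (unliftP ord_max j) => [j' ->|->]; rewrite ?snoc_lift ?snoc_max.
    exists (yi j'); rewrite expoB_at /= !var_at eqxx (negPf (yi_neq_si _ _)) //.
  (* The eliminated y contains every s to the power 1, and dividing by [s_l] cancels just one of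
     them. Another index exists since n + m + 2 is at least 2, which also covers m = 0. *)
  have [l' l'l] : exists l', l' != l.
    have [->|l0] := eqVneq l ord0; first by exists ord_max.
    by exists ord0; rewrite eq_sym.
  exists (si l'); rewrite 2!expoB_at (sum_var_at1 _ si_inj) var_at.
  by rewrite sum_var_at0 ?(inj_eq si_inj) ?(negPf l'l) // => i; rewrite eq_sym yi_neq_si.
- case/allpairsP => -[l j] [_ _ ->] /=; have [k tk] := t_expo_at_ti l; exists (ti k).
  by rewrite 2!expoB_at pq_expo_at y_expo_at_ti add0r subr0 oppr_eq0.
- case/allpairsPdep => i [j [_ + ->]] /=; rewrite mem_filter => /andP[ji _].
  apply: snoc_diff_neq0; [exact: yi_inj | | by rewrite eq_sym].
  move=> l; rewrite expoB_at (sum_var_at1 _ yi_inj) sum_var_at0 // => i'.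
  exact: yi_neq_si.
- case/allpairsP => -[l j] [_ _ ->] /=; have [k tk] := t_expo_at_ti j; exists (ti k).
  by rewrite expoD_at st add0r.
Qed.

Lemma off_diagonal_prod (q : C) (x : 'rV[C]_N) k b (w : 'I_k -> expo) :
  gamma_prod p (off_diagonal b w) q x =
  \prod_(i < k) \prod_(j < k | (i < j)%N)
    signed_pow b (ellGamma p q (monomial (coords p q x) (w i - w j)) *
                  ellGamma p q (monomial (coords p q x) (w j - w i))).
Proof.
rewrite /gamma_prod /off_diagonal big_allpairs_dep /=.
under eq_bigr do rewrite big_filter.
rewrite (prod_off_diagonal (fun i j =>
  signed_pow b (ellGamma p q (monomial (coords p q x) (w i - w j))))).
by apply: eq_bigr => i _; apply: eq_bigr => j _; rewrite signed_powM.
Qed.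

Variables (q : C) (x : 'rV[C]_N).
Hypothesis Dxq : domain (x, q).
Notation e := (monomial (coords p q x)).
Notation G := (ellGamma p q).

Lemma gamma_prod_rho_terms :
  rho p q (fun j => e (z_expo j)) (fun j => e (y_expo j))
    (fun l => e (s_expo l)) (fun l => e (t_expo l)) = gamma_prod p rho_terms q x.
Proof.
have X0 c : coords p q x c != 0 := coords_neq0 p_neq0 Dxq c.
have eD v w : e (v + w) = e v * e w := monomialD v w X0.
have eN v : e (- v) = (e v)^-1 := monomialN _ v.
have ec : e pq_expo = p * q by rewrite eD !monomial_delta.
have cat L1 L2 : gamma_prod p (L1 ++ L2) q x = gamma_prod p L1 q x * gamma_prod p L2 q x.
  exact: big_cat.
have pairs (I J : finType) b (f : I -> J -> expo) :
    gamma_prod p [seq (b, f i j) | i <- index_enum I, j <- index_enum J] q x =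
    signed_pow b (\prod_i \prod_j G (e (f i j))).
  rewrite /gamma_prod big_allpairs_dep /= signed_pow_prod; apply: eq_bigr => i _.
  by rewrite signed_pow_prod.
rewrite /rho_terms /term_list !cat !off_diagonal_prod !pairs /rho /Delta_kernel.
(* The sign flips because the kernel already holds reciprocals of these Gammas: z appears in the
   numerator kernel, y in the denominator one. *)
have inner k (w : 'I_k -> expo) (b : bool) :
    \prod_(i < k) \prod_(j < k | (i < j)%N) signed_pow b (G (e (w i - w j)) * G (e (w j - w i))) =
    signed_pow (~~ b) (\prod_(i < k) \prod_(j < k | (i < j)%N)
       (G (e (w i) * (e (w j))^-1) * G ((e (w i))^-1 * e (w j)))^-1).
  rewrite signed_pow_prod; apply: eq_bigr => i _; rewrite signed_pow_prod; apply: eq_bigr => j _.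
  by rewrite !eD !eN [(e (w j)) * _]mulrC; case: b; rewrite //= invrK.
rewrite (inner _ z_expo) (inner _ y_expo) /=.
have two k (f g : 'I_k -> 'I_(n + m).+2 -> C) :
    \prod_(j < k) \prod_(l < (n + m).+2) (f j l * g j l) =
    (\prod_l \prod_j f j l) * (\prod_l \prod_j g j l).
  rewrite exchange_big -big_split; apply: eq_bigr => l _ /=; exact: big_split.
have inv_prod k l (f : 'I_k -> 'I_l -> C) :
    \prod_i \prod_j (f i j)^-1 = (\prod_i \prod_j f i j)^-1.
  by rewrite -prodfV; apply: eq_bigr => i _; rewrite prodfV.
rewrite !two (inv_prod _ _ (fun k l => G (e (s_expo k) * e (t_expo l)))) !invfM.
have -> : \prod_l \prod_j G (e (s_expo l + z_expo j)) = \prod_l \prod_j G (e (s_expo l) * e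
  (z_expo j)).
  by apply: eq_bigr => l _; apply: eq_bigr => j _; rewrite eD.
have -> : \prod_l \prod_j G (e (t_expo l - z_expo j)) = \prod_l \prod_j G (e (t_expo l) * (e
  (z_expo j))^-1).
  by apply: eq_bigr => l _; apply: eq_bigr => j _; rewrite eD eN.
have -> : \prod_l \prod_j G (e (y_expo j - s_expo l)) = \prod_l \prod_j G ((e (s_expo l))^-1
  * e (y_expo j)).
  by apply: eq_bigr => l _; apply: eq_bigr => j _; rewrite eD eN mulrC.
have -> : \prod_l \prod_j G (e (pq_expo - t_expo l - y_expo j)) =
    \prod_l \prod_j G (p * q * (e (t_expo l))^-1 * (e (y_expo j))^-1).
  by apply: eq_bigr => l _; apply: eq_bigr => j _;
    rewrite (eD (pq_expo - _)) (eD pq_expo) ec 2!eN.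
have -> : \prod_k \prod_l G (e (s_expo k + t_expo l)) = \prod_k \prod_l G (e (s_expo k) * e
  (t_expo l)).
  by apply: eq_bigr => l _; apply: eq_bigr => j _; rewrite eD.
ring.
Qed.

Lemma rho_indepE : rho_indep p q x = gamma_prod p rho_terms q x.
Proof.
have X0 c : coords p q x c != 0 := coords_neq0 p_neq0 Dxq c.
rewrite -gamma_prod_rho_terms /rho_indep.
have ev i : e (var i) = x 0 i by rewrite monomial_delta.
have eS : e (\sum_l s_expo l) = \prod_l (lsubmx (rsubmx (rsubmx x)) : 'rV_(n + m).+2) 0 l.
  by rewrite monomial_sum //; apply: eq_bigr => l _; rewrite ev !mxE.
congr rho; apply/funext => j.
- rewrite /append_last /z_expo /snoc; case: unlift => [i|]; rewrite /= ?ev ?mxE //.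
  rewrite monomialN monomial_sum // -prodfV; apply: eq_bigr => i _; by rewrite ev !mxE.
- rewrite /append_last /y_expo /snoc; case: unlift => [i|]; rewrite /= ?ev ?mxE //.
  rewrite monomialD // monomialN eS monomial_sum // -prodfV; congr (_ * _).
  by apply: eq_bigr => i _; rewrite ev !mxE.
- by rewrite ev !mxE.
- rewrite /append_last /t_expo /snoc; case: unlift => [i|]; rewrite /= ?ev ?mxE //.
  rewrite monomialD // monomialN monomialD // eS monomial_sum //; congr (_ / (_ * _)).
    by rewrite pmulrn monomialMz monomialD // !monomial_delta.
  by apply: eq_bigr => i _; rewrite ev !mxE.
Qed.

End RhoTerms.

Theorem theorem9 (R : realType) (n m : nat) (p : CC R) (hp : 0 < `|p| < 1) :
  totally_elliptic p
    (fun (q : CC R) (x : 'rV[CC R]_(nvars n m)) => rho_indep p q x).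
Proof.
have [p0 p1] := (discP p).1 hp.
apply: (totally_elliptic_gamma_prod p0 p1 (L := rho_terms n m)).
- by move=> q x; exact: rho_indepE.
- exact: rho_terms_nonconstant.
- by move=> a b i; apply: certificate_cubic;
    [exact: sum_z_expo | exact: sum_y_expo | exact: sum_t_expo].
- by move=> a b; apply: certificate_even;
    [exact: sum_z_expo | exact: sum_y_expo | exact: sum_t_expo].
Qed.
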